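(* Let $0<p<+\infty$. Then there exists a holomorphic function $f$ on the open unit disc $D$ such that both of the following hold: 1) $\sup_{0<r<1}\int_0^{2\pi}|f(re^{i\theta})|^q\,d\theta<+\infty$ for all $0<q<p$; 2) $\sup_{0<r<1}\int_a^b|f(re^{i\theta})|^{\delta}\,d\theta=+\infty$ for all $\delta$ with $p\le\delta<+\infty$ and all real $a<b$. Moreover, the set of all such functions $f$ is a $G_\delta$ and dense subset of $\bigcap_{0<q<p}H^q$ endowed with its natural topology.
   Context: $D=\{z\in\mathbb{C}:|z|<1\}$. For $0<q<\infty$, $H^q=H^q(D)$ is the Hardy space of holomorphic functions $f$ on $D$ with $\sup_{0<r<1}\int_0^{2\pi}|f(re^{i\theta})|^q\,d\theta<+\infty$, with its usual complete metrizable vector space topology: $f_n\to f$ in $H^q$ iff $\sup_{0<r<1}\int_0^{2\pi}|f_n(re^{i\theta})-f(re^{i\theta})|^q\,d\theta\to0$. The natural topology of $\bigcap_{0<q<p}H^q$ is the metrizable topology in which $f_n\to f$ iff $f_n\to f$ in $H^q$ for every $q\in(0,p)$. *)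

(* Defs.v *)
From HB Require Import structures.
From mathcomp Require Import all_boot all_order all_algebra.
From mathcomp Require Import complex.
From mathcomp Require Import all_classical all_reals all_analysis.
Import Order.TTheory GRing.Theory Num.Theory.
Import numFieldNormedType.Exports.

Set Implicit Arguments.
Unset Strict Implicit.
Unset Printing Implicit Defensive.

Local Open Scope classical_set_scope.
Local Open Scope ring_scope.
Local Open Scope complex_scope.

Section HardyDefs.
Variable R : realType.
Implicit Types (f g : R[i] -> R[i]) (p q r a b : R).

Definition unit_disc : set R[i] := [set z | `|z| < 1].

(* The increments in [derivable] range over the scalars, here R[i], so this is
   complex differentiability. The regular module R[i]^o carries the topology. *)
Definition holomorphic_on_disc f : Prop :=
  forall z, unit_disc z -> derivable (f : R[i]^o -> R[i]^o) z 1.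

Definition circle_pt r t : R[i] := (r * cos t) +i* (r * sin t).

Definition arc_integral f q a b r : \bar R :=
  (\int[lebesgue_measure]_(t in `[a, b])
     (Normc.normc (f (circle_pt r t)) `^ q)%R%:E)%E.

Definition arc_sup f q a b : \bar R :=
  ereal_sup [set arc_integral f q a b r | r in [set r | 0 < r < 1]].

Definition hardy_sup f q : \bar R := arc_sup f q 0 (2 * pi).

(* The space \bigcap_{0<q<p} H^q. A holomorphic function on the disc is
   represented by its extension by 0, so that Leibniz equality of elements is
   equality on the disc. *)
Record hardy_cap p := HardyCap {
  hardy_fun :> R[i] -> R[i];
  hardy_fun_holo : holomorphic_on_disc hardy_fun;
  hardy_fun_out : forall z, ~ unit_disc z -> hardy_fun z = 0;
  hardy_fun_fin : forall q, 0 < q < p -> (hardy_sup hardy_fun q < +oo)%E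
}.

HB.instance Definition _ p := gen_eqMixin (hardy_cap p).
HB.instance Definition _ p := gen_choiceMixin (hardy_cap p).

Definition hardy_ball p (f : hardy_cap p) q (e : R) : set (hardy_cap p) :=
  [set g : hardy_cap p | (hardy_sup (g \- f)%R q < e%:E)%E].

Definition hardy_subbase p : set (set (hardy_cap p)) :=
  [set B | exists (f : hardy_cap p) (q e : R),
             [/\ 0 < q < p, 0 < e & B = hardy_ball f q e]].

(* The topology of H^q is given by the metric hardy_sup (f - g) q if q <= 1,
   and by its power of exponent 1/q if q >= 1; in both cases the open balls are
   the sets [hardy_ball f q e]. The natural topology of the intersection, in
   which convergence means convergence in every H^q with 0 < q < p, is the
   supremum of the topologies induced by these spaces, so it is generated by
   all these balls. *)
HB.instance Definition _ p :=
  @isSubBaseTopological.Build (hardy_cap p)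
    (set (hardy_cap p)) (@hardy_subbase p) id.

Definition exceptional p f : Prop :=
  (forall q, 0 < q < p -> (hardy_sup f q < +oo)%E) /\
  (forall d a b, p <= d -> a < b -> arc_sup f d a b = +oo%E).

End HardyDefs.

(* Main.v *)
(* Existence. For s > 2 let F(z) = sum_n c_n / (1 - a_n z) with
   a_n = (1 - d_n) e^{-i theta_n}, d_n = e^{-n^2}, c_n = e^n d_n^{1 - 1/s}, where
   theta_n takes every rational value infinitely often. All terms have
   nonnegative real part, so nothing cancels: on the circle of radius 1 - d_n and
   on [theta_n, theta_n + d_n] one has |F| >= c_n / (6 d_n), and the integral of
   |F|^s over this arc is at least 6^{-s} e^{ns}. For 2 <= q < s the integral of
   (c_n / |1 - a_n z|)^q is at most c_n^q d_n^{2-q} times the Poisson integral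
   2 pi / d_n, which is summable even against e^{nq}. Hence F is exceptional for
   the exponent s = N p, and F^N is exceptional for p.

   G_delta. By periodicity and |f|^p <= 1 + |f|^d it suffices to look at the
   exponent p and at rational arcs in [0, 2 pi]; for each of them the condition
   "the supremum exceeds n" is open, because the integral of |f|^p over a fixed
   arc of a fixed circle is lower semicontinuous for convergence in L^q.

   Density. Let v be exceptional. For every f and every arc there is at most one
   scalar c such that f + c v is bounded in L^p along the arc, so all but
   countably many c give an exceptional f + c v. *)
Require Import Defs.
From mathcomp Require Import all_boot all_order all_algebra.
From mathcomp Require Import complex.
From mathcomp Require Import all_classical all_reals all_analysis.
From mathcomp Require Import borel_hierarchy measurable_realfun.
From mathcomp Require Import finmap ring lra.
Import Order.TTheory GRing.Theory Num.Theory.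
Import numFieldNormedType.Exports.

Local Open Scope classical_set_scope.
Local Open Scope ring_scope.
Local Open Scope complex_scope.

Local Notation normc := Normc.normc.

Set Implicit Arguments.
Unset Strict Implicit.


(** * Modulus, continuity and holomorphy on the disc *)

Section ComplexDisc.
Context {R : realType}.
Implicit Types (z w : R[i]) (f g : R[i] -> R[i]).

Lemma normcCE z : `|z| = (normc z)%:C.
Proof. by []. Qed.

Lemma normc_ge0 z : 0 <= normc z.
Proof. by case: z => x y; exact: sqrtr_ge0. Qed.

Lemma unit_discE z : unit_disc z <-> normc z < 1.
Proof. by rewrite /unit_disc /= normcCE -[1]/(1%:C) ltcR. Qed.

Lemma normcX z n : normc (z ^+ n) = normc z ^+ n.
Proof.
by elim: n => [|n IH]; rewrite ?expr0 ?Normc.normc1// !exprS Normc.normcM IH.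
Qed.

Lemma normcB z w : normc (z - w) = normc (w - z).
Proof. by rewrite -opprB normcN. Qed.

Lemma normc_real_ge0 (x : R) : 0 <= x -> normc x%:C = x.
Proof. by move=> x0; rewrite /= expr0n/= addr0 sqrtr_sqr ger0_norm. Qed.

Lemma le_normcB z w : normc z - normc w <= normc (z - w).
Proof. by rewrite lerBlDr (le_trans _ (le_normcD _ _))// subrK. Qed.

Lemma normc_circle_pt (r t : R) : 0 <= r -> normc (circle_pt r t) = r.
Proof.
move=> r0; rewrite /circle_pt /= !exprMn -mulrDr cos2Dsin2 mulr1.
by rewrite sqrtr_sqr ger0_norm.
Qed.

Lemma circle_pt_disc (r t : R) : 0 < r < 1 -> unit_disc (circle_pt r t).
Proof. by case/andP=> r0 r1; apply/unit_discE; rewrite normc_circle_pt// ltW. Qed.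

(** The norm of [R[i]] takes its values in [R[i]]. A positive element there has zero imaginary part,
    so convergence can be tested with real radii. *)
Lemma cvg_normcP {T : Type} {F : set_system T} {FF : Filter F}
    (f : T -> R[i]^o) (l : R[i]^o) :
  f @ F --> l <-> forall e : R, 0 < e -> \forall x \near F, normc (l - f x) < e.
Proof.
split.
  move=> /cvgrPdist_lt fl e e0.
  have := fl e%:C; rewrite ltcR => /(_ e0).
  by apply: filterS => x; rewrite normcCE ltcR.
move=> fl; apply/cvgrPdist_lt => -[e e'].
rewrite ltcE/= => /andP[/eqP-> e0].
by apply: filterS (fl e e0) => x; rewrite normcCE -[e +i* 0]/(e%:C) ltcR.
Qed.

Lemma normc_le_add (x y : R) : normc (x +i* y) <= `|x| + `|y|.
Proof.
rewrite -(@ler_pXn2r _ 2)// ?nnegrE ?normc_ge0 ?addr_ge0//=.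
rewrite sqr_sqrtr ?addr_ge0 ?sqr_ge0//.
rewrite sqrrD !real_normK ?num_real//.
have := mulr_ge0 (normr_ge0 x) (normr_ge0 y); lra.
Qed.

Lemma cvg_complex {T : Type} {F : set_system T} {FF : Filter F}
    (u v : T -> R) (x y : R) :
  u @ F --> x -> v @ F --> y ->
  (fun t => u t +i* v t : R[i]^o) @ F --> (x +i* y : R[i]^o).
Proof.
move=> ux vy; apply/cvg_normcP => e e0.
have e2 : 0 < e / 2 by rewrite divr_gt0.
move/cvgrPdist_lt: ux => /(_ _ e2) ux.
move/cvgrPdist_lt: vy => /(_ _ e2) vy.
near=> t.
rewrite (_ : _ - _ = (x - u t) +i* (y - v t)); last first.
  by apply/eqP; rewrite eq_complex /= !eqxx.
apply: le_lt_trans (normc_le_add _ _) _.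
rewrite (splitr e) ltrD//; near: t; [exact: ux|exact: vy].
Unshelve. all: by end_near. Qed.

Lemma cvg_normc {T : Type} {F : set_system T} {FF : Filter F}
    (f : T -> R[i]^o) (l : R[i]^o) :
  f @ F --> l -> (fun t => normc (f t)) @ F --> normc l.
Proof.
move=> /cvg_normcP fl; apply/cvgrPdist_lt => e e0.
apply: filterS (fl e e0) => t; apply: le_lt_trans.
rewrite ler_norml lerNl opprB le_normcB andbT.
by rewrite (le_trans (le_normcB _ _))// normcB.
Qed.

Lemma holomorphic_continuous f z : holomorphic_on_disc f -> unit_disc z ->
  {for z, continuous (f : R[i]^o -> R[i]^o)}.
Proof.
move=> hf /hf df; apply: differentiable_continuous.
exact/derivable1_diffP.
Qed.

Lemma continuous_circle_pt (r : R) :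
  continuous (circle_pt r : R -> R[i]^o).
Proof.
move=> t; apply: (@cvg_complex _ _ _ (fun t => r * cos t) (fun t => r * sin t)).
- by apply: cvgM; [exact: cvg_cst|exact: continuous_cos].
- by apply: cvgM; [exact: cvg_cst|exact: continuous_sin].
Qed.

Lemma continuous_normc_circle f (r : R) : holomorphic_on_disc f -> 0 < r < 1 ->
  continuous (fun t => normc (f (circle_pt r t))).
Proof.
move=> hf r01 t.
apply: (@cvg_normc _ _ _ (f \o circle_pt r : R -> R[i]^o)).
apply: (@continuous_comp _ _ _ (circle_pt r : R -> R[i]^o) (f : R[i]^o -> R[i]^o)).
  exact: continuous_circle_pt.
by apply: holomorphic_continuous => //; exact: circle_pt_disc.
Qed.

Lemma holomorphic_cst (c : R[i]) : holomorphic_on_disc (fun=> c).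
Proof. by move=> z _; exact: derivable_cst. Qed.

Lemma holomorphicD f g : holomorphic_on_disc f -> holomorphic_on_disc g ->
  holomorphic_on_disc (f \+ g).
Proof. by move=> hf hg z zD; apply: derivableD; [exact: hf|exact: hg]. Qed.

Lemma holomorphicB f g : holomorphic_on_disc f -> holomorphic_on_disc g ->
  holomorphic_on_disc (f \- g).
Proof. by move=> hf hg z zD; apply: derivableB; [exact: hf|exact: hg]. Qed.

Lemma holomorphicZ f (c : R[i]) : holomorphic_on_disc f ->
  holomorphic_on_disc (fun z => c * f z).
Proof. by move=> hf z zD; apply: derivableZ; exact: hf. Qed.

Lemma holomorphicX f n : holomorphic_on_disc f ->
  holomorphic_on_disc (fun z => f z ^+ n).
Proof.
move=> hf; elim: n => [|n IH].
  by under eq_fun do rewrite expr0; exact: holomorphic_cst.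
under eq_fun do rewrite exprS.
by move=> z zD; apply: derivableM; [exact: hf|exact: IH].
Qed.

Lemma near_unit_disc z : unit_disc z -> \forall w \near (z : R[i]^o), unit_disc w.
Proof.
move=> zD.
have /cvg_normcP : (id : R[i]^o -> R[i]^o) w @[w --> (z : R[i]^o)] --> (z : R[i]^o) by exact: cvg_id.
have d0 : 0 < 1 - normc z by rewrite subr_gt0; exact/unit_discE.
move=> /(_ _ d0); apply: filterS => w; rewrite normcB => wz.
by apply/unit_discE; rewrite -(subrK z w) (le_lt_trans (le_normcD _ _))// -ltrBrDr.
Qed.

(** Derivability is local and the disc is open; this allows a function to be redefined outside the
    disc. *)
Lemma eq_on_disc_holomorphic f g : (forall z, unit_disc z -> f z = g z) ->
  holomorphic_on_disc f -> holomorphic_on_disc g.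
Proof.
move=> fg hf z zD; apply: near_eq_derivable (hf _ zD).
near=> w; apply: fg; near: w; exact: near_unit_disc.
Unshelve. all: by end_near. Qed.

End ComplexDisc.

(** * Integrals over arcs and their suprema over the radius *)

Section ArcIntegrals.
Context {R : realType}.
Implicit Types (z w : R[i]) (f g h : R[i] -> R[i]) (q a b r : R).

(** If y <= eta x, then x + y <= (1 + eta) x; otherwise x + y <= (1 + 1/eta) y. The bound serves all
    exponents at once, and the factor of x^q tends to 1 with eta, which keeps strict inequalities
    strict. *)
Lemma powR_quasi_triangle (x y q eta : R) : 0 <= x -> 0 <= y -> 0 <= q -> 0 < eta ->
  (x + y) `^ q <= (1 + eta) `^ q * x `^ q + (1 + eta^-1) `^ q * y `^ q.
Proof.
move=> x0 y0 q0 eta0; have eta1 : 0 < eta^-1 by rewrite invr_gt0.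
have [le0 le1] := (ltW eta0, ltW eta1).
have [yx|xy] := leP y (eta * x).
  rewrite -[leLHS]addr0 lerD ?mulr_ge0 ?powR_ge0// -powRM ?addr_ge0//.
  by rewrite ge0_ler_powR// ?nnegrE ?mulr_ge0 ?addr_ge0//; lra.
rewrite -[leLHS]add0r lerD ?mulr_ge0 ?powR_ge0// -powRM ?addr_ge0//.
rewrite ge0_ler_powR// ?nnegrE ?mulr_ge0 ?addr_ge0//.
by rewrite mulrDl mul1r addrC lerD2l mulrC ler_pdivlMr// mulrC ltW.
Qed.

Lemma powR_le_addr1 (x q q' : R) : 0 <= x -> 0 <= q <= q' -> x `^ q <= x `^ q' + 1.
Proof.
move=> x0 /andP[q0 qq]; have [x1|x1] := leP 1 x.
  by rewrite (le_trans (ler_powR x1 qq))// lerDl.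
have : x `^ q <= 1 `^ q by rewrite ge0_ler_powR ?nnegrE// ltW.
by rewrite powR1; have := powR_ge0 x q'; lra.
Qed.

Lemma continuous_powR_comp {T : topologicalType} (g : T -> R) q : 0 < q ->
  (forall t, 0 <= g t) -> continuous g -> continuous (fun t => g t `^ q).
Proof.
move=> q0 g0 cg t; have [gt0|gt0] := eqVneq (g t) 0; last first.
  apply: (@continuous_comp _ _ _ g (@powR R ^~ q)); first exact: cg.
  apply: differentiable_continuous; apply/derivable1_diffP/derivable_powR.
  by rewrite in_itv/= andbT lt0r gt0 g0.
apply/cvgrPdist_lt => e e0; rewrite gt0 powR0 ?gt_eqF//.
(* At a zero of [g] the chain rule does not apply; continuity is checked directly with the radius
   e^{1/q}. *)
have d0 : 0 < e `^ q^-1 by rewrite powR_gt0.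
have /cvgrPdist_lt/(_ _ d0) := cg t; apply: filterS => s.
rewrite gt0 !sub0r !normrN !ger0_norm ?powR_ge0// => gs.
have := gt0_ltr_powR q0; move=> /(_ _ _ _ _ gs); rewrite !nnegrE g0 ltW// => /(_ isT isT).
by rewrite -powRrM mulVf ?gt_eqF// powRr1// ltW.
Qed.

Lemma measurable_arc f r q (D : set R) : holomorphic_on_disc f -> 0 < r < 1 ->
  measurable_fun D (EFin \o (fun t => normc (f (circle_pt r t)) `^ q)).
Proof.
move=> hf r01; apply: measurable_funS (@subsetT _ D) _ => //.
apply/measurable_EFinP; apply: (@measurableT_comp _ _ _ _ _ _ (@powR R ^~ q)) => //.
apply: continuous_measurable_fun; exact: continuous_normc_circle.
Qed.

Lemma arc_integral_ge0 f q a b r : (0 <= arc_integral f q a b r)%E.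
Proof. by apply: integral_ge0 => t _; rewrite lee_fin powR_ge0. Qed.

(** Three functions with three exponents, so that a single integration covers changes of exponent,
    sums, scalar multiples and the semicontinuity estimate. *)
Lemma arc_integral_le2 f g h q1 q2 q3 (A B : R) a b r :
  holomorphic_on_disc f -> holomorphic_on_disc g -> holomorphic_on_disc h ->
  0 <= A -> 0 <= B -> 0 < r < 1 ->
  (forall t, a <= t <= b -> normc (f (circle_pt r t)) `^ q1 <=
     A * normc (g (circle_pt r t)) `^ q2 + B * normc (h (circle_pt r t)) `^ q3) ->
  (arc_integral f q1 a b r <=
   A%:E * arc_integral g q2 a b r + B%:E * arc_integral h q3 a b r)%E.
Proof.
move=> hf hg hh A0 B0 r01 fgh; rewrite /arc_integral.
have mg := measurable_arc (D := `[a, b]%classic) q2 hg r01.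
have mh := measurable_arc (D := `[a, b]%classic) q3 hh r01.
have mf := measurable_arc (D := `[a, b]%classic) q1 hf r01.
rewrite -!ge0_integralZl//; try by move=> t _; rewrite lee_fin powR_ge0.
rewrite -ge0_integralD//; first last.
- exact: measurable_funeM.
- by move=> t _; rewrite -EFinM lee_fin mulr_ge0 ?powR_ge0.
- exact: measurable_funeM.
- by move=> t _; rewrite -EFinM lee_fin mulr_ge0 ?powR_ge0.
apply: ge0_le_integral => //.
- by move=> t _; rewrite lee_fin powR_ge0.
- by apply: emeasurable_funD; exact: measurable_funeM.
Qed.

Lemma arc_integral_cst1 q a b r : a <= b ->
  arc_integral (fun=> 1) q a b r = (b - a)%:E.
Proof.
move=> ab; rewrite /arc_integral Normc.normc1 powR1 integral_cst//= mul1e.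
by rewrite lebesgue_measure_itv/= lte_fin; case: ltgtP ab => // -> _; rewrite subrr.
Qed.

Lemma arc_integral_subset f q a b a' b' r : holomorphic_on_disc f -> 0 < r < 1 ->
  a <= a' -> b' <= b -> (arc_integral f q a' b' r <= arc_integral f q a b r)%E.
Proof.
move=> hf r01 aa bb; apply: ge0_subset_integral => //.
- exact: measurable_arc.
- by move=> t _; rewrite lee_fin powR_ge0.
- by apply: subset_itv; rewrite bnd_simp.
Qed.

Lemma circle_pt_2pi r t : circle_pt r (t + 2 * pi) = circle_pt r t.
Proof. by rewrite /circle_pt mulr_natl cosD2pi sinD2pi. Qed.

Lemma arc_integral_shift f q a b r : 0 < q -> holomorphic_on_disc f -> 0 < r < 1 -> a <= b ->
  arc_integral f q (a + 2 * pi) (b + 2 * pi) r = arc_integral f q a b r.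
Proof.
move=> q0 hf r01 ab.
pose F (t : R) := t + 2 * pi.
have dF (x : R) : is_derive x (1:R) F 1.
  by rewrite -[X in is_derive _ _ _ X]addr0; apply: is_deriveD.
have F'E : derive1 F = cst 1.
  by apply/funext => x; rewrite derive1E; exact: derive_val.
have cF : continuous F.
  by move=> x; apply: differentiable_continuous; apply/derivable1_diffP.
pose G (t : R) := normc (f (circle_pt r t)) `^ q.
have cG : continuous G.
  apply: continuous_powR_comp => //; [by move=> t; exact: normc_ge0|].
  exact: continuous_normc_circle.
rewrite /arc_integral (@integration_by_substitution_increasing _ F G)//.
- by apply: eq_integral => x _; rewrite F'E !fctE /= mulr1 /G /F circle_pt_2pi.
- by move=> x y _ _; rewrite ltrD2r.
- by move=> x _; rewrite F'E; exact: cvg_cst.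
- by rewrite F'E; exact: is_cvg_cst.
- by rewrite F'E; exact: is_cvg_cst.
- split=> //; first by apply: cvg_at_right_filter; exact: cF.
  by apply: cvg_at_left_filter; exact: cF.
- exact: continuous_subspaceT.
Qed.

Lemma arc_sup_le2 f g h q1 q2 q3 (A B : R) a b :
  holomorphic_on_disc f -> holomorphic_on_disc g -> holomorphic_on_disc h ->
  0 <= A -> 0 <= B ->
  (forall z, unit_disc z -> normc (f z) `^ q1 <=
     A * normc (g z) `^ q2 + B * normc (h z) `^ q3) ->
  (arc_sup f q1 a b <= A%:E * arc_sup g q2 a b + B%:E * arc_sup h q3 a b)%E.
Proof.
move=> hf hg hh A0 B0 fgh; apply: ge_ereal_sup => _ [r r01 <-].
apply: le_trans (arc_integral_le2 hf hg hh A0 B0 r01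
  (fun t _ => fgh _ (circle_pt_disc t r01))) _.
by apply: leeD; apply: lee_wpmul2l; rewrite ?lee_fin//; apply: ereal_sup_ubound; exists r.
Qed.

Lemma arc_sup_cst1 q a b : a <= b -> arc_sup (fun=> 1) q a b = (b - a)%:E.
Proof.
move=> ab; apply/eqP; rewrite eq_le; apply/andP; split.
  by apply: ge_ereal_sup => _ [r _ <-]; rewrite arc_integral_cst1.
rewrite -(arc_integral_cst1 q (2^-1) ab); apply: ereal_sup_ubound; exists 2^-1 => //=.
by apply/andP; split; lra.
Qed.

Lemma arc_sup_ge0 f q a b : (0 <= arc_sup f q a b)%E.
Proof.
apply: le_trans (arc_integral_ge0 f q a b (2^-1)) _.
by apply: ereal_sup_ubound; exists 2^-1 => //=; apply/andP; split; lra.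
Qed.

(** Integrates x^q <= x^{q'} + 1, with the constant function 1 as the third function. An infinite
    supremum thus passes to larger exponents, a finite one to smaller exponents. *)
Lemma arc_sup_exponent f q q' a b : holomorphic_on_disc f -> 0 <= q <= q' ->
  a <= b -> (arc_sup f q a b <= arc_sup f q' a b + (b - a)%:E)%E.
Proof.
move=> hf qq ab.
have := @arc_sup_le2 f f (fun=> 1) q q' q 1 1 a b hf hf (@holomorphic_cst R 1) ler01 ler01.
rewrite arc_sup_cst1// !mul1e; apply => z _.
by rewrite Normc.normc1 powR1 !mul1r powR_le_addr1// normc_ge0.
Qed.

Lemma arc_supD f g q (eta : R) a b : holomorphic_on_disc f -> holomorphic_on_disc g ->
  0 <= q -> 0 < eta ->
  (arc_sup (f \+ g)%R q a b <=
   ((1 + eta) `^ q)%R%:E * arc_sup f q a b + ((1 + eta^-1) `^ q)%R%:E * arc_sup g q a b)%E.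
Proof.
move=> hf hg q0 eta0.
apply: (arc_sup_le2 a b (holomorphicD hf hg) hf hg (powR_ge0 _ _) (powR_ge0 _ _)).
move=> z _; apply: le_trans (powR_quasi_triangle _ _ _ _); rewrite ?normc_ge0//.
by rewrite ge0_ler_powR ?nnegrE ?addr_ge0 ?normc_ge0// le_normcD.
Qed.

Lemma arc_supZ f q (c : R[i]) a b : holomorphic_on_disc f ->
  (arc_sup (fun z => c * f z)%R q a b <= (normc c `^ q)%:E * arc_sup f q a b)%E.
Proof.
move=> hf; have := @arc_sup_le2 (fun z => c * f z) f f q q q (normc c `^ q) 0 a b
  (holomorphicZ hf) hf hf.
rewrite mul0e adde0; apply; rewrite ?powR_ge0// => z _.
by rewrite mul0r addr0 Normc.normcM powRM ?normc_ge0.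
Qed.

Lemma arc_sup_shift f q a b (k : int) : 0 < q -> holomorphic_on_disc f -> a <= b ->
  arc_sup f q (a + k%:~R * (2 * pi)) (b + k%:~R * (2 * pi)) = arc_sup f q a b.
Proof.
move=> q0 hf; rewrite /arc_sup.
have shiftn (n : nat) a1 b1 : a1 <= b1 ->
  [set arc_integral f q (a1 + n%:R * (2 * pi)) (b1 + n%:R * (2 * pi)) r | r in [set r | 0 < r < 1]] =
  [set arc_integral f q a1 b1 r | r in [set r | 0 < r < 1]].
  move=> ab; apply: eq_imagel => r r01; elim: n => [|n IH]; first by rewrite mul0r !addr0.
  by rewrite -IH -natr1 mulrDl mul1r !addrA arc_integral_shift// lerD2r.
case: k => n ab; first by rewrite -!pmulrn shiftn.
(* A backward shift is undone by moving the shifted arc forward by [n.+1] periods. *)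
rewrite NegzE -(shiftn n.+1) ?lerD2r//; congr ereal_sup; apply: eq_imagel => r _.
by rewrite mulrNz -!pmulrn mulNr !subrK.
Qed.

End ArcIntegrals.

(** * Reduction to rational arcs and semicontinuity estimates *)

Section HardyCap.
Context {R : realType}.
Implicit Types (z w : R[i]) (f g h : R[i] -> R[i]) (q a b r : R).

Lemma arc_sup_subset f q a b a' b' : holomorphic_on_disc f ->
  a <= a' -> b' <= b -> (arc_sup f q a' b' <= arc_sup f q a b)%E.
Proof.
move=> hf aa bb; apply: ge_ereal_sup => _ [r r01 <-].
apply: le_trans (arc_integral_subset q hf r01 aa bb) _.
by apply: ereal_sup_ubound; exists r.
Qed.

(** A countable family of arcs; inside [0, 2 pi] the integrals over them are controlled by
    [hardy_sup]. *)
Definition rational_arc (x y : rat) := [&& 0 <= x, x < y & ratr y <= 2 * pi :> R].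

Lemma arc_sup_rational_arcs p f : 0 < p -> holomorphic_on_disc f ->
  (forall x y, rational_arc x y -> arc_sup f p (ratr x) (ratr y) = +oo%E) ->
  forall d a b, p <= d -> a < b -> arc_sup f d a b = +oo%E.
Proof.
move=> p0 hf fxy d a b pd ab.
have pi0 := @pi_gt0 R.
pose T : R := 2 * pi; have T0 : 0 < T by rewrite /T; lra.
(* Subtracting [k] periods moves the midpoint into [0, 2 pi). To its right, below both the
   translated [b] and 2 pi, there is room for two rationals, which bound an arc inside the
   translated [a, b]. *)
pose m := (a + b) / 2; pose k := Num.floor (m / T).
have /andP[k1 k2] := floor_itv (m / T).
rewrite -/k intrD1 in k1 k2.
have m1 : 0 <= m - k%:~R * T by rewrite subr_ge0 -ler_pdivlMr.
have m2 : m - k%:~R * T < T.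
  by rewrite ltrBlDr; move: k2; rewrite ltr_pdivrMr// mulrDl mul1r addrC.
have lt1 : m - k%:~R * T < Num.min (b - k%:~R * T) T.
  by rewrite lt_min m2 andbT ltrD2r /m; lra.
have [x] := rat_in_itvoo lt1; rewrite in_itv/= => /andP[mx xb].
have [y] := rat_in_itvoo xb; rewrite in_itv/= lt_min => /andP[xy /andP[yb yT]].
have arcxy : rational_arc x y.
  apply/and3P; split; last exact: ltW.
    by rewrite -(ler0q R) (le_trans m1)// ltW.
  by rewrite -(ltr_rat R).
have := fxy _ _ arcxy => fp.
have pd0 : 0 <= p <= d by rewrite ltW.
have := arc_sup_exponent hf pd0 (ltW xy).
rewrite fp leye_eq => /eqP fd.
have fd' : arc_sup f d (ratr x) (ratr y) = +oo%E.
  by case: (arc_sup f d _ _) fd.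
apply/eqP; rewrite -leye_eq -fd' -(arc_sup_shift k (lt_le_trans p0 pd) hf (ltW xy)).
rewrite -/T; apply: arc_sup_subset => //.
  by move: mx; rewrite /m; lra.
by move: yb; lra.
Qed.

(** Absorbs the factor in front of the main term of the quasi-triangle inequality into a strict
    inequality. *)
Lemma powR_slack q (x e : R) : 0 < q -> 0 <= x -> x < e ->
  exists2 eta : R, 0 < eta & (1 + eta) `^ q * x < e.
Proof.
move=> q0 x0 xe; pose m := (x + e) / 2.
have m0 : 0 < m by rewrite /m; lra.
have xm : x < m by rewrite /m; lra.
have me : m < e by rewrite /m; lra.
have e0 : 0 < e by lra.
have em : 1 < e / m by rewrite ltr_pdivlMr// mul1r.
(* This makes (1 + eta)^q equal to e / m, and (e / m) x < e because x < m. *)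
exists ((e / m) `^ q^-1 - 1).
  have := @gt0_ltr_powR R q^-1; rewrite invr_gt0 => /(_ q0 1 (e / m)).
  by rewrite !nnegrE powR1 subr_gt0 => /(_ ler01 _ em); apply; rewrite ltW// (lt_trans _ em).
rewrite addrC subrK -powRrM mulVf ?gt_eqF// powRr1; last by rewrite ltW// (lt_trans _ em).
by rewrite mulrAC ltr_pdivrMr// ltr_pM2l.
Qed.

Lemma near0_powR_lt q (K e : R) : 0 < q -> 0 < e ->
  \forall c \near 0^'+, K * c `^ q < e.
Proof.
move=> q0 e0; apply: cvgr_lt e0.
rewrite -[X in _ --> X](mulr0 K); apply: cvgM; first exact: cvg_cst.
exact: powR_cvg0.
Qed.

(** If x > (1 + eta) y, then x <= y + d forces x <= (1 + 1/eta) d, and x^p = x^{p-q} x^q is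
    estimated with x <= M in the first factor. Hence closeness in the smaller exponent q bounds the
    p-integral of a bounded function from above. *)
Lemma powR_lsc (x y d M p q eta : R) : 0 <= x <= M -> 0 <= y -> 0 <= d ->
  x <= y + d -> 0 < q <= p -> 0 < eta ->
  x `^ p <= (1 + eta) `^ p * y `^ p +
            (M `^ (p - q) * (1 + eta^-1) `^ q) * d `^ q.
Proof.
move=> /andP[x0 xM] y0 d0 xyd /andP[q0 qp] eta0.
have eta1 : 0 < eta^-1 by rewrite invr_gt0.
have [le0 le1] := (ltW eta0, ltW eta1).
have p0 : 0 < p by exact: lt_le_trans qp.
have [xy|xy] := leP x ((1 + eta) * y).
  rewrite -[leLHS]addr0 lerD ?mulr_ge0 ?powR_ge0// -powRM ?addr_ge0//.
  by rewrite ge0_ler_powR// ?nnegrE ?mulr_ge0 ?addr_ge0// ltW.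
rewrite -[leLHS]add0r lerD ?mulr_ge0 ?powR_ge0//.
rewrite -mulrA -powRM ?addr_ge0// -{1}(subrK q p) (powRD _ (r := p - q)); last first.
  by rewrite subrK gt_eqF.
apply: ler_pM; rewrite ?powR_ge0//.
  by rewrite ge0_ler_powR ?nnegrE ?subr_ge0// (le_trans x0).
rewrite ge0_ler_powR ?nnegrE ?mulr_ge0 ?addr_ge0//; first exact: ltW.
rewrite mulrDl mul1r -(ler_pM2l eta0) mulrDr mulrA divff ?gt_eqF// mul1r.
by nra.
Qed.

Lemma divided_difference (K : fieldType) (x y a b : K) : a - b != 0 ->
  y = (a - b)^-1 * (x + a * y - (x + b * y)).
Proof. by move=> ab; rewrite opprD addrACA subrr add0r -mulrBl mulKf. Qed.

(** * The topology of the intersection and the G_delta property *)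

Variable p : R.
Hypothesis p0 : 0 < p.
Implicit Types u v : hardy_cap p.

(** Unfolds the topology generated by a subbase; conversely, [O] is the union of all finite
    intersections of balls contained in it. *)
Lemma hardy_openP (O : set (hardy_cap p)) : open O <->
  forall u, O u -> exists F : {fset set (hardy_cap p)},
    [/\ {subset F <= @hardy_subbase R p}, (forall B, B \in F -> B u) &
        \bigcap_(B in [set` F]) B `<=` O].
Proof.
have -> : open O = ([set \bigcup_(i in D') i | D' in
  subset^~ (finI_from (@hardy_subbase R p) id)]) O by [].
split.
  move=> [D' D'F <-] u [A AD Au]; have [F FF FA] := D'F _ AD.
  exists F; split; first exact: FF.
    by move=> B BF; move: Au; rewrite -FA; apply.
  by rewrite FA => v Av; exists A.
move=> OF.
exists [set A | finI_from (@hardy_subbase R p) id A /\ A `<=` O]; first by move=> A [].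
apply/seteqP; split => [u [A [_ AO]]|u Ou]; first exact: AO.
have [F [FF Fu FO]] := OF u Ou.
exists (\bigcap_(B in [set` F]) B) => //.
by split => //; exists F.
Qed.

Lemma half_exponent : 0 < p / 2 < p.
Proof. by rewrite divr_gt0//= ltr_pdivrMr// ltr_pMr// ltr1n. Qed.

Lemma hardy_cap_holo u : holomorphic_on_disc u.
Proof. by move=> z; apply: hardy_fun_holo. Qed.
Arguments hardy_cap_holo : clear implicits.

Lemma open_hardy_ball (O : set (hardy_cap p)) :
  (forall u, O u -> exists q e, [/\ 0 < q < p, 0 < e & hardy_ball u q e `<=` O]) ->
  open O.
Proof.
move=> OB; apply/hardy_openP => u /OB[q [e [q0 e0 BO]]].
exists [fset hardy_ball u q e]%fset; split.
- by move=> B; rewrite inE => /eqP ->; apply/mem_set; exists u, q, e.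
- move=> B; rewrite inE => /eqP ->; rewrite /hardy_ball/=.
  rewrite (le_lt_trans _ (_ : 0%:E < _)%E) ?lte_fin//.
  apply: ge_ereal_sup => _ [r r01 <-]; rewrite /arc_integral.
  have [qgt0 _] := andP q0.
  under eq_integral do rewrite /= subrr Normc.normc0 powR0 ?gt_eqF//.
  by rewrite integral0.
- by apply: subset_trans BO; apply: bigcap_inf; rewrite /= inE.
Qed.

(** A single circle witnesses that the supremum exceeds [n]. On it |u| is bounded by some [M], so
    [powR_lsc] with q = p / 2 shows that every [v] close to [u] in exponent p / 2 also exceeds [n]
    on this circle. *)
Lemma open_arc_sup_gt a b (n : R) : 0 <= a <= b -> b <= 2 * pi -> 0 <= n ->
  open [set u : hardy_cap p | (n%:E < arc_sup u p a b)%E].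
Proof.
move=> /andP[a0 ab] b2pi n0; apply: open_hardy_ball => u /= /ereal_sup_gt.
move=> [_ [r r01 <-] nI].
(* A real [A] is interposed because the integral is an extended real. *)
have [A nA AI] : exists2 A : R, n < A & (A%:E <= arc_integral u p a b r)%E.
  case: (arc_integral u p a b r) nI => [x|_|//]; first by rewrite lte_fin; exists x.
  by exists (n + 1); rewrite ?leey// ltrDl.
have hu := hardy_cap_holo u.
have [c _ uM] := EVT_max ab (continuous_subspaceT (continuous_normc_circle hu r01)).
set M := normc _ in uM.
have [eta eta0 etaA] := powR_slack p0 n0 nA.
have q0 : 0 < p / 2 <= p by have /andP[-> /ltW ->] := half_exponent.
pose C := M `^ (p - p / 2) * (1 + eta^-1) `^ (p / 2).
have C0 : 0 <= C by rewrite mulr_ge0 ?powR_ge0.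
pose s := A - (1 + eta) `^ p * n.
have s0 : 0 < s by rewrite subr_gt0.
(* [s] is the gap left by (1 + eta)^p n below [A]. With this radius the error C s / (C + 1) stays
   below [s]; the summand 1 covers C = 0. *)
exists (p / 2), (s / (C + 1)); split; first exact: half_exponent.
  by rewrite divr_gt0// ltr_wpDl.
move=> v; rewrite /hardy_ball/= => vu; have hv := hardy_cap_holo v.
rewrite ltNge; apply/negP => vn.
have : (A%:E <= ((1 + eta) `^ p * n)%R%:E + (C * (s / (C + 1)))%R%:E)%E.
  apply: le_trans AI _.
  have pe0 : 0 <= (1 + eta) `^ p by rewrite powR_ge0.
  apply: (le_trans (@arc_integral_le2 _ u v (v \- u) p p (p / 2) _ _ a b r
     hu hv (holomorphicB hv hu) pe0 C0 r01 _)).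
    move=> t tab; apply: powR_lsc => //; rewrite ?normc_ge0//=.
      by rewrite uM.
    by rewrite normcB -lerBlDl le_normcB.
  rewrite !EFinM leeD// lee_wpmul2l ?lee_fin//.
    by apply: le_trans vn; apply: ereal_sup_ubound; exists r.
  apply: le_trans (ltW vu).
  apply: le_trans (arc_integral_subset _ (holomorphicB hv hu) r01 a0 b2pi) _.
  by apply: ereal_sup_ubound; exists r.
rewrite -EFinD lee_fin; apply/negP; rewrite -ltNge -ltrBrDl -/s.
by rewrite mulrA ltr_pdivrMr ?ltr_wpDl// mulrC ltr_pM2l// ltrDl.
Qed.

Lemma exceptional_capP u : exceptional p u <->
  forall x y, rational_arc x y -> arc_sup u p (ratr x) (ratr y) = +oo%E.
Proof.
split=> [[_ uoo] x y /and3P[_ xy _]|uxy].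
  by apply: uoo => //; rewrite ltr_rat.
split; first exact: hardy_fun_fin.
exact: arc_sup_rational_arcs (hardy_cap_holo u) uxy.
Qed.

Lemma Gdelta_exceptional : Gdelta [set u : hardy_cap p | exceptional p u].
Proof.
(* The index encodes an arc and a threshold. Numbers that encode nothing, and pairs that are not
   rational arcs, give the whole space. *)
pose F i : set (hardy_cap p) :=
  match (choice.unpickle i : option (rat * rat * nat)) with
  | Some (x, y, n) => [set u : hardy_cap p | rational_arc x y ->
     ((n%:R)%:E < arc_sup u p (ratr x) (ratr y))%E]
  | None => setT end.
exists F.
  move=> i; rewrite /F; case: choice.unpickle => [[[x y] n]|]; last exact: openT.
  pose G := [set u : hardy_cap p | ((n%:R)%:E < arc_sup u p (ratr x) (ratr y))%E].
  have [xyP|nxy] := pselect (rational_arc x y); last first.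
    suff E : [set u | rational_arc x y -> G u] = setT.
      change (open [set u | rational_arc x y -> G u]); rewrite E; exact: openT.
    by apply/seteqP; split => // u _ /nxy.
  suff E : [set u | rational_arc x y -> G u] = G.
    change (open [set u | rational_arc x y -> G u]); rewrite E {E}/G.
    case/and3P: xyP => x0 xy y2; apply: open_arc_sup_gt => //.
    by rewrite ler0q x0 ler_rat ltW.
  by apply/seteqP; split => u /=; [exact|move=> Gu _].
apply/seteqP; split => u.
  move=> /exceptional_capP uP i _; rewrite /F.
  by case: choice.unpickle => [[[x y] n]|//] /uP ->; rewrite ltry.
move=> uF; apply/exceptional_capP => x y xyP.
apply/eqyP => A A0.
have := uF (choice.pickle (x, y, Num.truncn A)) I; rewrite /F choice.pickleK => /(_ xyP) /ltW.
(* The successor of the truncation is a threshold above [A]. *)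
have := uF (choice.pickle (x, y, (Num.truncn A).+1)) I; rewrite /F choice.pickleK => /(_ xyP) /ltW + _.
by apply: le_trans; rewrite lee_fin ltW// truncnS_gt.
Qed.

(** * Perturbation along a line and density *)

Lemma hardy_addZ_subproof u v (c : R) :
  let f := fun z => u z + c%:C * v z in
  [/\ holomorphic_on_disc f, (forall z, ~ unit_disc z -> f z = 0) &
      forall q, 0 < q < p -> (hardy_sup f q < +oo)%E].
Proof.
have [hu hv] := (hardy_cap_holo u, hardy_cap_holo v).
have hcv := holomorphicZ (c := c%:C) hv.
split; first exact: holomorphicD hu hcv.
  by move=> z zD; rewrite !hardy_fun_out// mulr0 addr0.
move=> q qp; have [q0 _] := andP qp.
apply: le_lt_trans (arc_supD 0 (2 * pi) hu hcv (ltW q0) ltr01) _.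
rewrite lte_add_pinfty// lte_mul_pinfty ?lee_fin ?powR_ge0//.
  exact: hardy_fun_fin.
apply: le_lt_trans (arc_supZ _ _ _ _ hv) _.
by rewrite lte_mul_pinfty ?lee_fin ?powR_ge0//; exact: hardy_fun_fin.
Qed.

(** The scalars are real, so that the bad ones form a subset of the line, where countable sets are
    Lebesgue null. *)
Lemma hardy_addZ_sig u v (c : R) :
  {w : hardy_cap p | forall z, w z = u z + c%:C * v z}.
Proof. by case: (hardy_addZ_subproof u v c) => h1 h2 h3; exists (HardyCap h1 h2 h3). Qed.

Definition hardy_addZ u v (c : R) : hardy_cap p := sval (hardy_addZ_sig u v c).

Lemma hardy_addZE u v c z : hardy_addZ u v c z = u z + c%:C * v z.
Proof. exact: svalP (hardy_addZ_sig u v c) z. Qed.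

(** A subbasic ball around some [w] contains [u] with room to spare. Part of this room absorbs the
    factor (1 + eta)^q, the rest absorbs the contribution of c v, which is at most a constant times
    c^q. *)
Lemma near_hardy_addZ u v (O : set (hardy_cap p)) : open O -> O u ->
  \forall c \near 0^'+, O (hardy_addZ u v c).
Proof.
move=> /hardy_openP OF /OF[F [FF Fu FO]].
have [hu hv] := (hardy_cap_holo u, hardy_cap_holo v).
suff : \forall c \near 0^'+, (\bigcap_(B in [set` F]) B) (hardy_addZ u v c).
  by apply: filterS => c; exact: FO.
suff FB B : B \in F -> \forall c \near 0^'+, B (hardy_addZ u v c).
  exact: (@filter_bigI _ _ F (fun B c => B (hardy_addZ u v c)) (0:R)^'+ _ FB).
move=> BF; have := Fu _ BF; have /set_mem[w [q [e [qp e0 ->]]]] := FF _ BF.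
rewrite /hardy_ball/= => uw; have [q0 _] := andP qp; have hw := hardy_cap_holo w.
have huw := holomorphicB hu hw.
have x0 := arc_sup_ge0 (u \- w) q 0 (2 * pi).
have := @hardy_fun_fin _ _ v _ qp; have := arc_sup_ge0 v q 0 (2 * pi).
rewrite -/(hardy_sup v q) -/(hardy_sup (u \- w) q) in x0 *.
case vH : (hardy_sup v q) => [H|//|//] => H0 _.
case uwX : (hardy_sup (u \- w) q) uw x0 => [X|//|//]; rewrite lte_fin !lee_fin => Xe X0.
have [eta eta0 etaX] := powR_slack q0 X0 Xe.
have s0 : 0 < e - (1 + eta) `^ q * X by rewrite subr_gt0.
near=> c.
have c0 : 0 < c by near: c; exact: nbhs_right_gt.
have -> : (hardy_addZ u v c \- w)%R = ((u \- w) \+ (fun z => c%:C * v z))%R.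
  by apply/funext => z /=; rewrite hardy_addZE addrAC.
apply: le_lt_trans (arc_supD _ _ huw (holomorphicZ hv) (ltW q0) eta0) _.
rewrite -/(hardy_sup (u \- w) q) uwX.
have K0 : 0 <= (1 + eta^-1) `^ q by rewrite powR_ge0.
apply: (@le_lt_trans _ _ (((1 + eta) `^ q)%:E * X%:E + ((1 + eta^-1) `^ q * H * c `^ q)%:E)%E).
  rewrite leeD// mulrAC -mulrA EFinM lee_wpmul2l//.
  apply: le_trans (arc_supZ _ _ _ _ hv) _.
  by rewrite -/(hardy_sup v q) vH normc_real_ge0 ?(ltW c0).
rewrite -EFinM -EFinD lte_fin -ltrBrDl.
by near: c; exact: near0_powR_lt.
Unshelve. all: by end_near. Qed.

Lemma dense_exceptional v : (forall a b, a < b -> arc_sup v p a b = +oo%E) ->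
  dense [set u : hardy_cap p | exceptional p u].
Proof.
move=> voo O [u Ou] oO; have hv := hardy_cap_holo v.
have /nbhs_ballP[c0 /= c00 c0O] := near_hardy_addZ v oO Ou.
pose bad (xy : rat * rat) := [set c : R | rational_arc xy.1 xy.2 /\
  (arc_sup (hardy_addZ u v c) p (ratr xy.1) (ratr xy.2) < +oo)%E].
(* For two distinct bad scalars of one arc, [v] would be a multiple of the difference of two
   functions with finite supremum there, against the hypothesis on [v]. *)
have bad_uniq xy c c' : bad xy c -> bad xy c' -> c = c'.
  move=> [/and3P[_ xy1 _] cfin] [_ c'fin]; apply/eqP/negPn/negP => cc'.
  have ccC : c%:C - c'%:C != 0.
    by rewrite subr_eq0; apply/eqP => /complexI/eqP; apply/negP.
  set k := (c%:C - c'%:C)^-1.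
  have K0 : 0 <= normc k `^ p by rewrite powR_ge0.
  have E z : v z = k * (hardy_addZ u v c z - hardy_addZ u v c' z).
    by rewrite (hardy_addZE u v c) (hardy_addZE u v c'); exact: divided_difference.
  have : (arc_sup v p (ratr xy.1) (ratr xy.2) < +oo)%E.
    have A0 : 0 <= normc k `^ p * (1 + 1) `^ p.
      by rewrite mulr_ge0// powR_ge0.
    have hc := hardy_cap_holo (hardy_addZ u v c).
    have hc' := hardy_cap_holo (hardy_addZ u v c').
    have Af (x : \bar R) : (x < +oo)%E ->
        ((normc k `^ p * (1 + 1) `^ p)%R%:E * x < +oo)%E.
      by move=> xoo; apply: lte_mul_pinfty.
    apply: le_lt_trans (arc_sup_le2 _ _ hv hc hc' A0 A0 _)
      (lte_add_pinfty (Af _ cfin) (Af _ c'fin)).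
    move=> z _; rewrite E Normc.normcM powRM ?normc_ge0// -!mulrA -mulrDr.
    rewrite ler_wpM2l//.
    have := @powR_quasi_triangle R _ _ p 1 (normc_ge0 (hardy_addZ u v c z))
      (normc_ge0 (hardy_addZ u v c' z)) (ltW p0) ltr01.
    rewrite invr1; apply: le_trans.
    rewrite ge0_ler_powR ?nnegrE ?addr_ge0 ?normc_ge0 ?(ltW p0)//.
    by rewrite -[in leRHS](normcN (hardy_addZ u v c' z)) le_normcD.
  by rewrite voo// ltr_rat.
have : countable (\bigcup_xy bad xy).
  apply: bigcup_countable => // xy _.
  have [[c bc]|nbad] := pselect (exists c, bad xy c).
    suff -> : bad xy = [set c] by exact: countable1.
    by apply/seteqP; split => [c' bc'|_ ->//]; exact: bad_uniq bc' bc.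
  suff -> : bad xy = set0 by exact: countable0.
  by apply/seteqP; split => // c bc; apply: nbad; exists c.
move=> /(@countable_lebesgue_measure0 R) bad0.
(* The bad scalars form a null set, which cannot contain an interval of length c0 > 0. *)
have [c [/andP[cgt0 cc0] cgood]] : exists c, 0 < c < c0 /\ ~ (\bigcup_xy bad xy) c.
  apply: contrapT => nex.
  have : (lebesgue_measure `]0%R, c0[ <= lebesgue_measure (\bigcup_xy bad xy))%E.
    apply: le_outer_measure => c; rewrite /= in_itv/= => c01.
    by apply: contrapT => nbad; apply: nex; exists c.
  by rewrite bad0 lebesgue_measure_itv/= lte_fin c00 oppr0 adde0 lee_fin leNgt c00.
exists (hardy_addZ u v c); split.
  by apply: c0O => //; rewrite /ball/= sub0r normrN gtr0_norm.
apply/exceptional_capP => x y xyP; apply: contrapT => /eqP nfin.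
by apply: cgood; exists (x, y) => //; split => //=; rewrite ltey.
Qed.

End HardyCap.

(** * Series of Cauchy kernels and their holomorphy *)

Section CauchyKernelSeries.
Context {R : realType}.
Implicit Types (z w : R[i]).

Lemma normc_sum (u : nat -> R[i]) n :
  normc (\sum_(j < n) u j) <= \sum_(j < n) normc (u j).
Proof.
elim: n => [|n IH]; first by rewrite !big_ord0 Normc.normc0.
by rewrite !big_ord_recr/= (le_trans (le_normcD _ _))// lerD2r.
Qed.

Lemma cvg_normc_le (u : nat -> R[i]) (l : R[i]) (K : R) :
  (u : nat -> R[i]^o) @ \oo --> (l : R[i]^o) -> (forall n, normc (u n) <= K) ->
  normc l <= K.
Proof.
by move=> /cvg_normc ul uK; apply: (cvgr_to_le ul); exact: nearW.
Qed.

Lemma cvg_normc_ge (u : nat -> R[i]) (l : R[i]) (K : R) N :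
  (u : nat -> R[i]^o) @ \oo --> (l : R[i]^o) ->
  (forall n, (N <= n)%N -> K <= normc (u n)) -> K <= normc l.
Proof.
move=> /cvg_normc ul uK; apply: (cvgr_to_ge ul).
by exists N => // n; exact: uK.
Qed.

Lemma is_cvg_bounded_series (b : nat -> R) (C : R) : (forall n, 0 <= b n) ->
  (forall n, \sum_(j < n) b j <= C) -> cvgn (series b).
Proof.
move=> b0 bC; apply: nondecreasing_is_cvgn.
  by apply/nondecreasing_seqP => n; rewrite /series/= big_nat_recr//= lerDl.
by exists C => _ [n _ <-]; rewrite /series/= big_mkord.
Qed.

(** Comparison test, applied to the real and imaginary parts as absolutely convergent real
    series. *)
Lemma is_cvg_complex_series (u : nat -> R[i]) (b : nat -> R) (C : R) :
  (forall n, normc (u n) <= b n) -> (forall n, \sum_(j < n) b j <= C) ->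
  cvg ((fun n => \sum_(j < n) u j : R[i]^o) @ \oo).
Proof.
move=> ub bC; have b0 n : 0 <= b n by exact: le_trans (normc_ge0 _) (ub n).
have cb := is_cvg_bounded_series b0 bC.
have cvg_part (v : nat -> R) : (forall n, `|v n| <= normc (u n)) -> cvgn (series v).
  move=> vu; apply: normed_cvg; apply: (series_le_cvg _ b0 _ cb) => n //=.
  exact: le_trans (vu n) (ub n).
have cre : cvgn (series (fun n => complex.Re (u n))).
  by apply: (cvg_part (fun k => complex.Re (u k))) => n; have := normc_ge_Re (u n); rewrite normcCE lecR.
have cim : cvgn (series (fun n => complex.Im (u n))).
  apply: (cvg_part (fun k => complex.Im (u k))) => n; case: (u n) => x y /=.
  by rewrite -sqrtr_sqr ler_wsqrtr// lerDr sqr_ge0.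
have -> : (fun n => \sum_(j < n) u j) = (fun n =>
    series (fun k => complex.Re (u k)) n +i* series (fun k => complex.Im (u k)) n).
  apply/funext => n; rewrite /series/= !big_mkord.
  elim: n => [|n IH]; first by rewrite !big_ord0.
  rewrite !big_ord_recr/= IH.
  by case: (u n) => x y; apply/eqP; rewrite eq_complex/= !eqxx.
exact: (cvgP _ (cvg_complex cre cim)).
Qed.

Variables (c : nat -> R) (a : nat -> R[i]) (C : R).
Hypothesis c0 : forall n, 0 <= c n.
Hypothesis cC : forall n, \sum_(j < n) c j <= C.
Hypothesis a1 : forall n, normc (a n) <= 1.

Definition cauchy_term n z : R[i] := (c n)%:C / (1 - a n * z).

(** On the disc the limit exists because |1 - a_n z| >= 1 - |z| and the weights are summable. *)
Definition cauchy_sum z : R[i] :=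
  lim ((fun n => \sum_(j < n) cauchy_term j z : R[i]^o) @ \oo).

Lemma normc_1Bmul_ge n z : 1 - normc z <= normc (1 - a n * z).
Proof.
apply: le_trans (le_normcB _ _); rewrite Normc.normc1 lerD2l lerN2.
by rewrite Normc.normcM ler_piMl ?normc_ge0.
Qed.

Lemma normc_1Bmul_gt0 n z : unit_disc z -> 0 < normc (1 - a n * z).
Proof.
by move=> /unit_discE z1; rewrite (lt_le_trans _ (normc_1Bmul_ge n z))// subr_gt0.
Qed.

Lemma oneBmul_neq0 n z : unit_disc z -> 1 - a n * z != 0.
Proof.
move=> /(normc_1Bmul_gt0 n); apply: contraTneq => ->.
by rewrite Normc.normc0 ltxx.
Qed.

Lemma normc_cauchy_term n z : normc (cauchy_term n z) = c n / normc (1 - a n * z).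
Proof. by rewrite Normc.normcM Normc.normcV normc_real_ge0. Qed.

Lemma sum_le_scale (d : R) n : 0 <= d -> \sum_(j < n) c j * d <= C * d.
Proof. by move=> d0; rewrite -mulr_suml ler_wpM2r. Qed.

Lemma cvg_cauchy_sum z : unit_disc z ->
  (fun n => \sum_(j < n) cauchy_term j z : R[i]^o) @ \oo --> (cauchy_sum z : R[i]^o).
Proof.
move=> zD; have z1 : 0 < 1 - normc z by rewrite subr_gt0; exact/unit_discE.
apply: (@is_cvg_complex_series (fun j => cauchy_term j z)
    (fun n => c n * (1 - normc z)^-1) (C * (1 - normc z)^-1)).
  move=> n; rewrite normc_cauchy_term ler_wpM2l// lef_pV2 ?posrE//.
    exact: normc_1Bmul_ge.
  exact: normc_1Bmul_gt0.
by move=> n; apply: sum_le_scale; rewrite invr_ge0 ltW.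
Qed.

(** Derivative of one kernel minus its difference quotient, in closed form; the factor [h] makes the
    error vanish linearly. *)
Lemma cauchy_term_slope (al A z h : R[i]) : h != 0 -> 1 - A * z != 0 ->
  1 - A * (h + z) != 0 ->
  al * A / (1 - A * z) ^+ 2 - h^-1 * (al / (1 - A * (h + z)) - al / (1 - A * z)) =
  - (al * A ^+ 2 * h) / ((1 - A * z) ^+ 2 * (1 - A * (h + z))).
Proof. by move=> h0 z0 hz0; field; rewrite h0 z0 hz0. Qed.

Lemma slope_bound (k al h x y d : R) : 0 <= k -> 0 <= al -> al <= 1 -> 0 <= h ->
  0 < d -> d <= x -> d <= y -> k * al ^+ 2 * h / (x ^+ 2 * y) <= k * (h / d ^+ 3).
Proof.
move=> k0 al0 al1 h0 d0 dx dy; have x0 := lt_le_trans d0 dx.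
have y0 := lt_le_trans d0 dy; have ld0 := ltW d0.
rewrite mulrA; apply: ler_pM.
- by rewrite !mulr_ge0// exprn_ge0.
- by rewrite invr_ge0 mulr_ge0 ?exprn_ge0 ?(ltW x0) ?(ltW y0).
- by rewrite ler_wpM2r// -[leRHS]mulr1 ler_wpM2l// exprn_ile1.
- rewrite lef_pV2 ?posrE ?mulr_gt0 ?exprn_gt0//.
  rewrite exprSr; apply: ler_pM => //; first by rewrite exprn_ge0.
  by rewrite lerXn2r ?nnegrE ?(ltW x0).
Qed.

Lemma near0_normc_lt (e : R) : 0 < e ->
  \forall h \near nbhs (0 : R[i]^o), normc h < e.
Proof.
have /cvg_normcP h : (id : R[i]^o -> R[i]^o) w @[w --> (0 : R[i]^o)] --> (0 : R[i]^o) by exact: cvg_id.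
by move=> /h; apply: filterS => w; rewrite sub0r normcN.
Qed.

(** Termwise differentiation: the errors of the difference quotients add up to at most C |h| / d^3
    for every partial sum, and the bound passes to the limit. *)
Lemma holomorphic_cauchy_sum : holomorphic_on_disc cauchy_sum.
Proof.
(* Half the distance to the unit circle: for |h| <= d every denominator at z and at z + h has
   modulus at least [d]. *)
move=> z zD; pose d : R := (1 - normc z) / 2.
have z1 : normc z < 1 by exact/unit_discE.
have d0 : 0 < d by rewrite /d; lra.
pose dterm n : R[i] := (c n)%:C * a n / (1 - a n * z) ^+ 2.
have disc_h h : normc h <= d -> unit_disc (h + z).
  move=> hd; apply/unit_discE; apply: le_lt_trans (le_normcD _ _) _.
  by move: hd; rewrite /d; lra.
have dz n : d <= normc (1 - a n * z).
  by apply: le_trans (normc_1Bmul_ge n z); rewrite /d; lra.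
have dh n h : normc h <= d -> d <= normc (1 - a n * (h + z)).
  move=> hd; apply: le_trans (normc_1Bmul_ge n _).
  have := le_normcD h z; move: hd; rewrite /d; lra.
have cG : cvg ((fun n => \sum_(j < n) dterm j : R[i]^o) @ \oo).
  apply: (@is_cvg_complex_series dterm (fun n => c n * d^-2) (C * d^-2)).
    move=> n; rewrite !Normc.normcM Normc.normcV normcX normc_real_ge0//.
    apply: ler_pM => //; rewrite ?mulr_ge0 ?normc_ge0 ?invr_ge0 ?exprn_ge0 ?normc_ge0//.
      by rewrite -[leRHS]mulr1 ler_wpM2l.
    by rewrite lef_pV2 ?posrE ?exprn_gt0 ?normc_1Bmul_gt0// lerXn2r ?nnegrE ?normc_ge0 ?(ltW d0).
  by move=> n; apply: sum_le_scale; rewrite invr_ge0 exprn_ge0// ltW.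
set G := lim _ in cG.
pose quot h : R[i] := h^-1 * (cauchy_sum (h + z) - cauchy_sum z).
have bound h : h != 0 -> normc h <= d -> normc (G - quot h) <= C / d ^+ 3 * normc h.
  move=> h0 hd; have hzD := disc_h _ hd.
  pose u n := \sum_(j < n) dterm j -
    h^-1 * (\sum_(j < n) cauchy_term j (h + z) - \sum_(j < n) cauchy_term j z).
  apply: (@cvg_normc_le u).
    apply: cvgB; first exact: cG.
    apply: cvgM; first exact: cvg_cst.
    by apply: cvgB; exact: cvg_cauchy_sum.
  move=> n; rewrite /u -sumrB mulr_sumr -sumrB.
  apply: le_trans (normc_sum (fun j => dterm j -
    h^-1 * (cauchy_term j (h + z) - cauchy_term j z)) n) _.
  rewrite mulrAC -mulrA; apply: le_trans (sum_le_scale n _); last first.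
    by rewrite mulr_ge0 ?normc_ge0 ?invr_ge0 ?exprn_ge0 ?ltW.
  apply: ler_sum => j _.
  rewrite /dterm /cauchy_term cauchy_term_slope ?oneBmul_neq0//.
  rewrite Normc.normcM normcN Normc.normcV [normc (_ * h)]Normc.normcM.
  rewrite [normc ((c j)%:C * _)]Normc.normcM [normc (_ * (1 - _))]Normc.normcM.
  rewrite !normcX normc_real_ge0//.
  apply: slope_bound => //; rewrite ?normc_ge0 ?a1//; exact: dh.
have C0 : 0 <= C by have := cC 0; rewrite big_ord0.
pose K := C / d ^+ 3; have K0 : 0 <= K by rewrite divr_ge0// exprn_ge0// ltW.
apply/cvg_ex; exists (G : R[i]^o); apply/cvg_normcP => e e0.
have K1 : 0 < K + 1 by rewrite ltr_wpDl.
near=> h.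
have h0 : h != 0 by near: h; exact: nbhs_dnbhs_neq.
have hd : normc h < d by near: h; apply: cvg_within; exact: near0_normc_lt.
have he : normc h < e / (K + 1).
  by near: h; apply: cvg_within; apply: near0_normc_lt; exact: divr_gt0.
rewrite (_ : h *: (1 : R[i]^o) = h); last by rewrite /GRing.scale/= mulr1.
apply: le_lt_trans (bound h h0 (ltW hd)) _.
rewrite -/K; have := normc_ge0 h; move: he; rewrite ltr_pdivlMr// mulrDr mulr1 => he nh.
by rewrite mulrC (le_lt_trans _ he)// lerDl.
Unshelve. all: by end_near. Qed.

End CauchyKernelSeries.

(** * The Poisson integral and bounds for the real part of a kernel *)

Section PoissonKernel.
Context {R : realType}.
Implicit Types (x t rho theta phi : R).

Lemma sin_le x : 0 <= x -> sin x <= x.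
Proof.
move=> x0; have [|c _] := @MVT_segment R (@sin R) (@cos R) 0 x x0 (fun y _ => is_derive_sin y).
  by apply: continuous_subspaceT; exact: continuous_sin.
by rewrite sin0 !subr0 => ->; rewrite ler_piMl// cos_le1.
Qed.

Lemma oneB_cos_le x : 0 <= x -> 1 - cos x <= x ^+ 2.
Proof.
move=> x0; have [|c] := @MVT_segment R (@cos R) (fun y => - sin y) 0 x x0
    (fun y _ => is_derive_cos y).
  by apply: continuous_subspaceT; exact: continuous_cos.
rewrite in_itv/= cos0 subr0 => /andP[c0 cx] /(congr1 -%R).
rewrite opprB mulNr opprK => ->; rewrite expr2 ler_wpM2r//.
exact: le_trans (sin_le c0) cx.
Qed.

Lemma circle_ptM (r s t u : R) : circle_pt r t * circle_pt s u = circle_pt (r * s) (t + u).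
Proof.
apply/eqP; rewrite eq_complex/= cosD sinD; apply/andP; split; apply/eqP; ring.
Qed.

Lemma sqr_normc_1B rho phi : normc (1 - circle_pt rho phi) ^+ 2 =
  1 - 2 * rho * cos phi + rho ^+ 2.
Proof.
rewrite /= sqr_sqrtr ?addr_ge0 ?sqr_ge0// add0r sqrrN exprMn.
have := cos2Dsin2 phi; move=> /(congr1 (fun y => rho ^+ 2 * y)).
by rewrite mulr1 => E; rewrite -[in RHS]E; ring.
Qed.

Lemma poisson_den_gt0 rho phi : 0 <= rho < 1 -> 0 < 1 - 2 * rho * cos phi + rho ^+ 2.
Proof.
by move=> /andP[r0 r1]; have := cos_le1 phi; nra.
Qed.

Lemma oneB_rho_cos_gt0 rho phi : 0 <= rho < 1 -> 0 < 1 - rho * cos phi.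
Proof. by move=> /andP[r0 r1]; have := cos_le1 phi; nra. Qed.

(** The arctangent is minus the argument of 1 - rho e^{i(t - theta)}. For 0 <= rho < 1 this number
    has positive real part, so the primitive is smooth on the whole line, without jumps between
    branches. *)
Definition poisson_primitive rho theta t : R :=
  t + 2 * atan (rho * sin (t - theta) / (1 - rho * cos (t - theta))).

(** Pure algebra in the cosine [co] and the sine [si]; the left side has the shape that the
    differentiation rules produce. *)
Lemma poisson_identity (rho co si : R) : 1 - rho * co != 0 ->
  1 - 2 * rho * co + rho ^+ 2 != 0 -> co ^+ 2 + si ^+ 2 = 1 ->
  1 + 2 * ((1 + (rho * si / (1 - rho * co)) ^+ 2)^-1 *
    (rho * si * (- (1 - rho * co) ^- 2 * (rho * si)) +
     (1 - rho * co)^-1 * (rho * co))) =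
  (1 - rho ^+ 2) / (1 - 2 * rho * co + rho ^+ 2).
Proof.
move=> D0 den0 cs; have siE : si ^+ 2 = 1 - co ^+ 2 by rewrite -cs addrAC subrr add0r.
have -> : 1 + (rho * si / (1 - rho * co)) ^+ 2 =
    (1 - 2 * rho * co + rho ^+ 2) / (1 - rho * co) ^+ 2.
  by rewrite expr_div_n exprMn siE; field.
have -> : rho * si * (- (1 - rho * co) ^- 2 * (rho * si)) =
    - (rho ^+ 2 * (1 - co ^+ 2)) / (1 - rho * co) ^+ 2.
  by rewrite -siE; field.
by field; rewrite D0 den0.
Qed.

Lemma is_derive_poisson_primitive rho theta t : 0 <= rho < 1 ->
  is_derive t 1 (poisson_primitive rho theta)
    ((1 - rho ^+ 2) / (1 - 2 * rho * cos (t - theta) + rho ^+ 2)).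
Proof.
move=> r01; rewrite /poisson_primitive.
have d0 := oneB_rho_cos_gt0 (t - theta) r01.
have p0 := poisson_den_gt0 (t - theta) r01.
pose S t := rho * sin (t - theta).
pose D t := 1 - rho * cos (t - theta).
have ds : is_derive t 1 (fun t => t - theta) 1.
  by rewrite -[X in is_derive _ _ _ X]subr0; apply: is_deriveB.
have dsin : is_derive t 1 (fun t => sin (t - theta)) (cos (t - theta)).
  exact: is_derive_eq (@is_derive1_comp R sin (fun t => t - theta) t _ _ (is_derive_sin _) ds) (mulr1 _).
have dcos : is_derive t 1 (fun t => cos (t - theta)) (- sin (t - theta)).
  exact: is_derive_eq (@is_derive1_comp R cos (fun t => t - theta) t _ _ (is_derive_cos _) ds) (mulr1 _).
have dS : is_derive t 1 S (rho * cos (t - theta)).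
  apply: is_derive_eq (is_deriveM (is_derive_cst rho t 1) dsin) _.
  by rewrite /GRing.scale/= mulr0 addr0.
have dD : is_derive t 1 D (rho * sin (t - theta)).
  apply: is_derive_eq (is_deriveB (is_derive_cst (1 : R) t 1)
    (is_deriveM (is_derive_cst rho t 1) dcos)) _.
  by rewrite /GRing.scale/= mulr0 addr0 sub0r mulrN opprK.
have Dt0 : D t != 0 by rewrite gt_eqF.
have dq := is_deriveM dS (is_deriveV Dt0 dD).
have dA := @is_derive1_comp R atan _ t _ _ (is_derive1_atan _) dq.
apply: is_derive_eq (is_deriveD (is_derive_id t 1) (is_deriveM (is_derive_cst (2:R) t 1) dA)) _.
rewrite /GRing.scale/= mulr0 addr0.
apply: poisson_identity; rewrite ?gt_eqF//.
exact: cos2Dsin2.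
Qed.

Lemma continuous_poisson rho theta : 0 <= rho < 1 ->
  continuous (fun t => (1 - rho ^+ 2) / (1 - 2 * rho * cos (t - theta) + rho ^+ 2)).
Proof.
move=> r01 t; apply: cvgM; first exact: cvg_cst.
apply: cvgV; first by rewrite gt_eqF// poisson_den_gt0.
apply: cvgD; last exact: cvg_cst.
apply: cvgB; first exact: cvg_cst.
apply: cvgM; first exact: cvg_cst.
apply: (@continuous_comp _ _ _ (fun t => t - theta) (@cos R)); last exact: continuous_cos.
by apply: cvgB; [exact: cvg_id|exact: cvg_cst].
Qed.

(** The arctangent part of the primitive is periodic and cancels; only the linear part
    contributes. *)
Lemma integral_poisson rho theta : 0 <= rho < 1 ->
  (\int[lebesgue_measure]_(t in `[0%R, (2 * pi : R)%R])
     (((1 - rho ^+ 2) / (1 - 2 * rho * cos (t - theta) + rho ^+ 2))%R)%:E = (2 * pi)%:E)%E.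
Proof.
move=> r01; have pi2 : 0 < 2 * pi :> R by rewrite mulr_gt0// pi_gt0.
have dG t := @is_derive_poisson_primitive rho theta t r01.
have cG : continuous (poisson_primitive rho theta).
  by move=> t; apply: differentiable_continuous; apply/derivable1_diffP.
rewrite (@continuous_FTC2 _ _ (poisson_primitive rho theta))//.
- rewrite /poisson_primitive -EFinB; congr EFin.
  have -> : 2 * pi - theta = - theta + pi *+ 2 by rewrite addrC mulr_natl.
  by rewrite cosD2pi sinD2pi !sub0r; ring.
- apply: continuous_subspaceT; exact: continuous_poisson.
- split; first by [].
  by apply: cvg_at_right_filter; exact: cG.
  by apply: cvg_at_left_filter; exact: cG.
- by move=> t _; rewrite derive1E; exact: derive_val.
Qed.

Lemma Re_kernel (k : R) (w : R[i]) :
  complex.Re (k%:C / (1 - w)) = k * ((1 - complex.Re w) / normc (1 - w) ^+ 2).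
Proof.
case: w => x y /=; rewrite sqr_sqrtr ?addr_ge0 ?sqr_ge0//.
by rewrite /GRing.inv/=; ring.
Qed.

Lemma Re_le_normc (w : R[i]) : complex.Re w <= normc w.
Proof.
have := normc_ge_Re w; rewrite normcCE lecR; exact: le_trans (ler_norm _).
Qed.

Lemma Re_kernel_ge0 (k : R) (w : R[i]) : 0 <= k -> normc w <= 1 ->
  0 <= complex.Re (k%:C / (1 - w)).
Proof.
move=> k0 w1; rewrite Re_kernel mulr_ge0// divr_ge0 ?sqr_ge0// subr_ge0.
exact: le_trans (Re_le_normc w) w1.
Qed.

(** The modulus rho = (1 - delta)^2 is that of the pole parameter times the radius of the circle.
    Then 1 - rho cos phi >= delta, while |1 - w|^2 = (1 - rho)^2 + 2 rho (1 - cos phi) <= 4 delta^2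
    + 2 delta^2. *)
Lemma Re_kernel_peak (k delta phi : R) : 0 <= k -> 0 < delta <= 1 ->
  0 <= phi <= delta ->
  k / (6 * delta) <= complex.Re (k%:C / (1 - circle_pt ((1 - delta) ^+ 2) phi)).
Proof.
move=> k0 /andP[d0 d1] /andP[p0 pd].
have rho0 : 0 <= (1 - delta) ^+ 2 by rewrite sqr_ge0.
have cp := oneB_cos_le p0; have c1 := cos_le1 phi.
rewrite Re_kernel sqr_normc_1B ler_wpM2l//=.
set rho := (1 - delta) ^+ 2 in rho0 *.
have rhoE : rho = (1 - delta) ^+ 2 by [].
have rho1 : rho <= 1 - delta by rewrite rhoE; nra.
have den0 : 0 < 1 - 2 * rho * cos phi + rho ^+ 2.
  by apply: poisson_den_gt0; rewrite rho0; lra.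
have den6 : 1 - 2 * rho * cos phi + rho ^+ 2 <= 6 * delta ^+ 2.
  have h1 : (1 - rho) ^+ 2 <= 4 * delta ^+ 2.
    have -> : 4 * delta ^+ 2 = (2 * delta) ^+ 2 by ring.
    rewrite lerXn2r ?nnegrE//; try lra.
    by rewrite rhoE; nra.
  have h2 : rho * (1 - cos phi) <= delta ^+ 2.
    apply: (@le_trans _ _ (1 * phi ^+ 2)); first by apply: ler_pM => //; lra.
    by rewrite mul1r lerXn2r ?nnegrE// ltW.
  by nra.
rewrite ler_pdivlMr// mulrC ler_pdivrMr; last by rewrite mulr_gt0.
apply: le_trans den6 _; rewrite expr2.
have : delta <= 1 - rho * cos phi by nra.
by nra.
Qed.

End PoissonKernel.

(** * The peak series and its divergence on every arc *)

Section Peaks.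
Context {R : realType}.
Implicit Types (n : nat) (z : R[i]).

Definition peak_width n : R := expR (- (n%:R ^+ 2)).

(** The 2-adic valuation takes every natural value infinitely often, so each rational is the angle
    of infinitely many peaks; valuations that encode no rational give the angle 0. *)
Definition peak_angle n : R :=
  ratr (odflt 0 (choice.unpickle (logn 2 n) : option rat)).

(** The angle is negated so that the product with a point of angle [t] has angle
    [t - peak_angle n]. *)
Definition peak_pole n : R[i] := circle_pt (1 - peak_width n) (- peak_angle n).

Lemma peak_width_gt0 n : 0 < peak_width n.
Proof. exact: expR_gt0. Qed.

Lemma peak_width_le1 n : peak_width n <= 1.
Proof. by rewrite /peak_width expR_le1 oppr_le0 sqr_ge0. Qed.

Lemma peak_width_lt1 n : (0 < n)%N -> peak_width n < 1.
Proof. by move=> n0; rewrite /peak_width expR_lt1 oppr_lt0 exprn_gt0// ltr0n. Qed.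

Lemma normc_peak_pole n : normc (peak_pole n) = 1 - peak_width n.
Proof. by rewrite normc_circle_pt// subr_ge0 peak_width_le1. Qed.

Lemma normc_peak_pole_le1 n : normc (peak_pole n) <= 1.
Proof. by rewrite normc_peak_pole lerBlDr lerDl ltW// peak_width_gt0. Qed.

Definition geom_bound : R := (1 - expR (- 1))^-1.

Lemma geom_bound_gt0 : 0 < geom_bound.
Proof. by rewrite invr_gt0 subr_gt0 expR_lt1 oppr_lt0. Qed.

Lemma sum_expRN n : \sum_(j < n) expR (- j%:R) <= geom_bound.
Proof.
have x1 : 0 < 1 - expR (- 1) :> R by rewrite subr_gt0 expR_lt1 oppr_lt0.
rewrite /geom_bound -[leRHS]mul1r ler_pdivlMr//.
suff -> : (\sum_(j < n) expR (- j%:R)) * (1 - expR (- 1)) = 1 - expR (- n%:R) :> R.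
  by rewrite lerBlDr lerDl expR_ge0.
elim: n => [|n IH]; first by rewrite big_ord0 mul0r oppr0 expR0 subrr.
by rewrite big_ord_recr/= mulrDl IH -natr1 opprD expRD; ring.
Qed.

Variable s : R.
Hypothesis s2 : 2 < s.

Let s0 : 0 < s. Proof. by apply: lt_trans s2. Qed.

(** This is e^n d_n^{1 - 1/s}, for which (c_n / d_n)^s d_n is exactly e^{ns}. *)
Definition peak_coef n : R := expR (n%:R - n%:R ^+ 2 * (1 - s^-1)).

Definition peak_sum : R[i] -> R[i] := cauchy_sum peak_coef peak_pole.

Lemma peak_coef_ge0 n : 0 <= peak_coef n.
Proof. exact: expR_ge0. Qed.

(** As 1 - 1/s >= 1/2, the exponent is at most n - n^2 / 2, which is at most 2 - n because (n - 2)^2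
    >= 0. *)
Lemma peak_coef_le n : peak_coef n <= expR 2 * expR (- n%:R).
Proof.
rewrite -expRD ler_expR; have si : s^-1 <= 2^-1 by rewrite lef_pV2 ?posrE// ltW.
have := sqr_ge0 (n%:R - 2 : R); have := sqr_ge0 (n%:R : R); nra.
Qed.

Lemma sum_peak_coef n : \sum_(j < n) peak_coef j <= expR 2 * geom_bound.
Proof.
apply: (@le_trans _ _ (\sum_(j < n) expR 2 * expR (- j%:R))).
  by apply: ler_sum => j _; exact: peak_coef_le.
by rewrite -mulr_sumr ler_wpM2l ?expR_ge0// sum_expRN.
Qed.

Lemma holomorphic_peak_sum : holomorphic_on_disc peak_sum.
Proof.
exact: (holomorphic_cauchy_sum peak_coef_ge0 sum_peak_coef normc_peak_pole_le1).
Qed.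

Lemma cvg_peak_sum z : unit_disc z ->
  (fun n => \sum_(j < n) cauchy_term peak_coef peak_pole j z : R[i]^o) @ \oo -->
  (peak_sum z : R[i]^o).
Proof.
exact: (cvg_cauchy_sum peak_coef_ge0 sum_peak_coef normc_peak_pole_le1).
Qed.

Lemma Re_term_le_sum (u : nat -> R[i]) n m : (forall j, 0 <= complex.Re (u j)) ->
  (n < m)%N -> complex.Re (u n) <= complex.Re (\sum_(j < m) u j).
Proof.
move=> u0; have ReD (x y : R[i]) : complex.Re (x + y) = complex.Re x + complex.Re y.
  by case: x y => [a b] [c d].
have S0 k : 0 <= complex.Re (\sum_(j < k) u j).
  elim: k => [|k IH]; first by rewrite big_ord0.
  by rewrite big_ord_recr/= ReD addr_ge0.
elim: m => // m IH; rewrite ltnS leq_eqVlt big_ord_recr/= ReD.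
move=> /orP[/eqP ->|nm]; first by rewrite lerDr S0.
by rewrite (le_trans (IH nm))// lerDl.
Qed.

Lemma peak_sum_lower n t : (0 < n)%N ->
  peak_angle n <= t <= peak_angle n + peak_width n ->
  peak_coef n / (6 * peak_width n) <= normc (peak_sum (circle_pt (1 - peak_width n) t)).
Proof.
move=> n0 /andP[t1 t2]; have d0 := peak_width_gt0 n; have d1 := peak_width_lt1 n0.
have r01 : 0 < 1 - peak_width n < 1 by apply/andP; split; lra.
have zD := circle_pt_disc t r01.
(* Partial sums with at least [n.+1] terms contain term [n]; all real parts are nonnegative, so that
   term alone is a lower bound. *)
apply: (cvg_normc_ge (N := n.+1) (cvg_peak_sum zD)) => m nm.
apply: le_trans (Re_le_normc _).
apply: le_trans (Re_term_le_sum (u := fun j =>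
  cauchy_term peak_coef peak_pole j (circle_pt (1 - peak_width n) t)) _ nm).
  rewrite /cauchy_term /peak_pole circle_ptM -expr2; apply: Re_kernel_peak.
  - exact: peak_coef_ge0.
  - by rewrite d0 ltW.
  - by apply/andP; split; lra.
move=> j; apply: Re_kernel_ge0; first exact: peak_coef_ge0.
rewrite Normc.normcM mulr_ile1 ?normc_ge0 ?normc_peak_pole_le1//.
by rewrite normc_circle_pt; lra.
Qed.

Lemma peak_height n :
  (peak_coef n / (6 * peak_width n)) `^ s * peak_width n = 6^-1 `^ s * expR (n%:R * s).
Proof.
have -> : peak_coef n / (6 * peak_width n) = 6^-1 * expR (n%:R + n%:R ^+ 2 / s).
  rewrite invfM mulrCA -expRN -expRD opprK; congr (_ * expR _); ring.
rewrite powRM ?invr_ge0 ?expR_ge0// -expRM -mulrA -expRD; congr (_ * expR _).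
by rewrite mulrDl divfK ?gt_eqF// addrK.
Qed.

Lemma arc_sup_peak_sum_ge n a b : (0 < n)%N -> a <= peak_angle n ->
  peak_angle n + peak_width n <= b ->
  ((6^-1 `^ s * expR (n%:R * s))%:E <= arc_sup peak_sum s a b)%E.
Proof.
move=> n0 an nb; have d0 := peak_width_gt0 n; have d1 := peak_width_lt1 n0.
have r01 : 0 < 1 - peak_width n < 1 by apply/andP; split; lra.
have hF := holomorphic_peak_sum.
apply: (@le_trans _ _ (arc_integral peak_sum s a b (1 - peak_width n))); last first.
  by apply: ereal_sup_ubound; exists (1 - peak_width n).
apply: le_trans (arc_integral_subset s hF r01 an nb).
rewrite -peak_height EFinM.
have <- : (\int[lebesgue_measure]_(t in `[peak_angle n, (peak_angle n + peak_width n)%R])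
    ((peak_coef n / (6 * peak_width n)) `^ s)%R%:E =
    ((peak_coef n / (6 * peak_width n)) `^ s)%R%:E * (peak_width n)%:E)%E.
  rewrite integral_cst//= lebesgue_measure_itv/= lte_fin ltrDl d0.
  by rewrite -EFinB addrAC subrr add0r.
apply: ge0_le_integral => //.
- by move=> t _; rewrite lee_fin powR_ge0.
- exact: measurable_arc.
- move=> t; rewrite /= in_itv/= => tI.
  rewrite lee_fin ge0_ler_powR ?nnegrE ?normc_ge0 ?(ltW s0) ?peak_sum_lower//.
  by rewrite divr_ge0 ?peak_coef_ge0// mulr_ge0// ltW.
Qed.

Lemma peak_angle_dense a b N : a < b -> exists n, [/\ (N < n)%N,
  a <= peak_angle n & peak_angle n + peak_width n <= b].
Proof.
move=> ab; have [q] := rat_in_itvoo ab; rewrite in_itv/= => /andP[aq qb].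
pose M := (Num.truncn (b - ratr q)^-1).+1; pose j := choice.pickle q.
have M1 : (b - ratr q)^-1 < M%:R by exact: truncnS_gt.
(* The odd factor leaves the valuation equal to the code [j] of [q] and makes [n] exceed both [N]
   and [M]. *)
pose n := (2 ^ j * (2 * (N + M)).+1)%N; exists n.
have nNM : (N + M < n)%N.
  rewrite /n (@leq_trans (2 * (N + M)).+1)//; last by rewrite leq_pmull// expn_gt0.
  by rewrite ltnS leq_pmull.
have jn : logn 2 n = j.
  rewrite /n lognM ?expn_gt0// pfactorK// logn_coprime ?addn0//.
  by rewrite coprime2n /= oddM.
have qE : peak_angle n = ratr q by rewrite /peak_angle jn choice.pickleK.
split; first by apply: leq_ltn_trans nNM; rewrite leq_addr.
  by rewrite qE ltW.
have bq : 0 < b - ratr q by rewrite subr_gt0.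
rewrite qE -lerBrDl /peak_width expRN -[leRHS]invrK lef_pV2 ?posrE ?expR_gt0 ?invr_gt0//.
(* The peak fits because e^{n^2} >= 1 + n^2 >= n >= M > 1 / (b - q). *)
have := expR_ge1Dx (n%:R ^+ 2 : R); apply: le_trans.
have Mn : M%:R <= n%:R :> R by rewrite ler_nat (leq_trans (leq_addl N M))// ltnW.
have n1 : 1 <= n%:R :> R by rewrite ler1n (leq_ltn_trans _ nNM).
have : n%:R <= n%:R ^+ 2 :> R by rewrite expr2 ler_peMl// (le_trans _ n1).
lra.
Qed.

Lemma arc_sup_peak_sum a b : a < b -> arc_sup peak_sum s a b = +oo%E.
Proof.
move=> ab; apply/eqyP => A A0; pose k : R := 6^-1 `^ s.
have k0 : 0 < k by rewrite powR_gt0// invr_gt0.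
(* Any n > N satisfies n >= A / k, and e^{ns} >= 1 + ns >= n. *)
pose N := Num.truncn (A / k).
have [n [Nn an nb]] := peak_angle_dense N ab.
have n0 : (0 < n)%N by exact: leq_ltn_trans Nn.
apply: le_trans (arc_sup_peak_sum_ge n0 an nb); rewrite lee_fin -/k.
rewrite mulrC -ler_pdivrMr// (@le_trans _ _ n%:R)//.
  by rewrite (le_trans (ltW (truncnS_gt _)))// ler_nat.
apply: le_trans (expR_ge1Dx _); have : 0 <= n%:R :> R by [].
have := s2; nra.
Qed.

End Peaks.

(** * Finiteness of the Hardy suprema of the peak series below the exponent [s] *)

Section PeakSumHardy.
Context {R : realType}.
Implicit Types (n j : nat) (z : R[i]).

(** The integrand is the Poisson kernel of parameter rho = (1 - d) r divided by 1 - rho^2, and 1 -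
    rho^2 >= 1 - rho >= d. *)
Lemma integral_sqr_kernel n (r : R) : 0 < r < 1 ->
  (\int[lebesgue_measure]_(t in `[0%R, (2 * pi : R)%R])
     (((normc (1 - peak_pole n * circle_pt r t) ^+ 2)^-1)%R)%:E <=
   (2 * pi / peak_width n)%R%:E)%E.
Proof.
move=> /andP[r0 r1]; have d0 := @peak_width_gt0 R n; have d1 := @peak_width_le1 R n.
set d := peak_width n in d0 d1 *; pose rho := (1 - d) * r.
have rho0 : 0 <= rho by rewrite mulr_ge0 ?subr_ge0// ltW.
have rho1 : rho <= 1 - d by rewrite ler_piMr ?subr_ge0// ltW.
have rho01 : 0 <= rho < 1 by rewrite rho0; lra.
have e0 : 0 < 1 - rho ^+ 2 by nra.
have pi2 : 0 < 2 * pi :> R by rewrite mulr_gt0// pi_gt0.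
pose P t := (1 - rho ^+ 2) / (1 - 2 * rho * cos (t - peak_angle n) + rho ^+ 2).
have P0 t : 0 <= P t by rewrite divr_ge0 ?ltW// poisson_den_gt0.
have E t : (normc (1 - peak_pole n * circle_pt r t) ^+ 2)^-1 = (1 - rho ^+ 2)^-1 * P t.
  rewrite /peak_pole circle_ptM -/d -/rho sqr_normc_1B addrC.
  by rewrite /P mulKf ?gt_eqF// addrC [- _ + t]addrC.
under eq_integral => t _ do rewrite E EFinM.
rewrite ge0_integralZl//.
- rewrite integral_poisson// -EFinM lee_fin mulrC ler_wpM2l ?(ltW pi2)//.
  rewrite lef_pV2 ?posrE//; nra.
- apply/measurable_EFinP; apply: measurable_funS (@subsetT _ _) _ => //.
  by apply: continuous_measurable_fun; exact: continuous_poisson.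
- by move=> t _; rewrite lee_fin P0.
- by rewrite lee_fin invr_ge0 ltW.
Qed.

(** Only q - 2 of the q factors 1/N are replaced by 1/d; the remaining square is integrated exactly
    by the Poisson formula. *)
Lemma cauchy_term_powR (c N d q : R) : 0 <= c -> 0 < d -> d <= N -> 2 <= q ->
  (c / N) `^ q <= c `^ q * d^-1 `^ (q - 2) * (N ^+ 2)^-1.
Proof.
move=> c0 d0 dN q2; have N0 := lt_le_trans d0 dN.
have Ni : 0 < N^-1 by rewrite invr_gt0.
rewrite powRM ?(ltW Ni)// -mulrA ler_wpM2l ?powR_ge0//.
rewrite -{1}(subrK 2 q) (powRD (r := q - 2)); last by rewrite (gt_eqF Ni) implybT.
rewrite (_ : N^-1 `^ 2 = (N ^+ 2)^-1); last by rewrite powR_mulrn ?(ltW Ni)// exprVn.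
rewrite ler_wpM2r ?invr_ge0 ?exprn_ge0 ?(ltW N0)//.
by rewrite ge0_ler_powR ?nnegrE ?subr_ge0 ?invr_ge0 ?(ltW N0) ?(ltW d0)// lef_pV2.
Qed.

(* A series is controlled by [sup_j e^j x_j], hence its q-th power by the sum of
   the [(e^j x_j)^q]; this avoids Minkowski's inequality. *)
Lemma powR_le_nneseries (y q : R) (x : nat -> R) : 0 < q -> 0 <= y ->
  (forall j, 0 <= x j) ->
  (forall K, (forall n, \sum_(j < n) x j <= K) -> y <= K) ->
  ((y `^ q)%:E <= (geom_bound `^ q)%:E *
     \sum_(j <oo) (expR (j%:R * q) * x j `^ q)%:E)%E.
Proof.
move=> q0 y0 x0 yK; have G0 := @geom_bound_gt0 R.
have t0 j : (0 <= (expR (j%:R * q) * x j `^ q)%:E)%E.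
  by rewrite lee_fin mulr_ge0 ?expR_ge0 ?powR_ge0.
have S0 : (0 <= \sum_(j <oo) (expR (j%:R * q) * x j `^ q)%:E)%E.
  by apply: nneseries_ge0 => j _ _; exact: t0.
case SE : (\sum_(j <oo) _)%E S0 => [S| |] S0.
- rewrite lee_fin in S0; rewrite -EFinM lee_fin.
  have xS j : expR (j%:R * q) * x j `^ q <= S.
    rewrite -lee_fin -SE; apply: le_trans (nneseries_lim_ge j.+1 (fun n _ _ => t0 n)).
    by rewrite big_nat_recr//= leeDr// sume_ge0.
  have xj j : x j <= S `^ q^-1 * expR (- j%:R).
    rewrite expRN ler_pdivlMr ?expR_gt0//.
    have e0 : 0 <= x j * expR j%:R by rewrite mulr_ge0 ?expR_ge0.
    rewrite -[leLHS]powRr1// -[X in _ `^ X <= _](mulfV (lt0r_neq0 q0)) powRrM.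
    rewrite ge0_ler_powR ?nnegrE ?powR_ge0 ?invr_ge0 ?(ltW q0)//.
    rewrite powRM ?expR_ge0// -expRM mulrC.
    exact: xS.
  have yG : y <= S `^ q^-1 * geom_bound.
    apply: yK => n; apply: (@le_trans _ _ (\sum_(j < n) S `^ q^-1 * expR (- j%:R))).
      by apply: ler_sum => j _.
    by rewrite -mulr_sumr ler_wpM2l ?powR_ge0// sum_expRN.
  apply: (@le_trans _ _ ((S `^ q^-1 * geom_bound) `^ q)).
    by rewrite ge0_ler_powR ?nnegrE ?mulr_ge0 ?powR_ge0 ?(ltW q0) ?(ltW G0).
  rewrite powRM ?powR_ge0 ?(ltW G0)// -powRrM mulVf ?gt_eqF// powRr1//.
  by rewrite mulrC.
- by rewrite gt0_muley ?leey// lte_fin powR_gt0.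
- by [].
Qed.

Variable s : R.
Hypothesis s2 : 2 < s.

Let s0 : 0 < s. Proof. by apply: lt_trans s2. Qed.

Lemma peak_exponent q : 2 <= q < s -> exists K, forall j,
  expR (j%:R * q) * (peak_coef s j `^ q * (peak_width j)^-1 `^ (q - 2) *
    (2 * pi / peak_width j)) <= K * expR (- j%:R) :> R.
Proof.
move=> /andP[q2 qs]; pose k := 1 - q / s.
have k0 : 0 < k by rewrite subr_gt0 ltr_pdivrMr// mul1r.
(* The logarithm of the left side, apart from 2 pi, is 2 q j - k j^2 with k > 0. Completing the
   square bounds it by [K0] - j. *)
pose K0 := (2 * q + 1) ^+ 2 / (4 * k).
exists (2 * pi * expR K0) => j; rewrite /peak_coef /peak_width -!expRN opprK.
rewrite -!expRM !(mulrCA _ (2 * pi)) -mulrA ler_pM2l ?mulr_gt0 ?pi_gt0//.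
rewrite -!expRD ler_expR; set x : R := j%:R.
have : 0 <= k * (x - (2 * q + 1) / (2 * k)) ^+ 2 by rewrite mulr_ge0 ?sqr_ge0// ltW.
rewrite (_ : k * _ = k * x ^+ 2 - (2 * q + 1) * x + K0); last first.
  by rewrite /K0; field; rewrite gt_eqF.
rewrite (_ : x * q + _ = 2 * q * x - k * x ^+ 2); last first.
  by rewrite /k; field; rewrite gt_eqF.
lra.
Qed.

Lemma normc_peak_sum_le z K : unit_disc z ->
  (forall n, \sum_(j < n) peak_coef s j / normc (1 - peak_pole j * z) <= K) ->
  normc (peak_sum s z) <= K.
Proof.
move=> zD xK; apply: (cvg_normc_le (cvg_peak_sum s2 zD)) => n.
apply: le_trans (normc_sum (fun j => cauchy_term (peak_coef s) (@peak_pole R) j z) n) _.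
apply: le_trans (xK n); apply: ler_sum => j _.
by rewrite normc_cauchy_term// => k; exact: peak_coef_ge0.
Qed.

Lemma normc_1B_peak_pole_ge n z : unit_disc z ->
  peak_width n <= normc (1 - peak_pole n * z).
Proof.
move=> /unit_discE z1; apply: le_trans (le_normcB _ _).
rewrite Normc.normc1 Normc.normcM normc_peak_pole lerBrDl -lerBrDr.
by rewrite ler_piMr ?(ltW z1)// subr_ge0 peak_width_le1.
Qed.

Lemma measurable_peak_term n (r q k c : R) (D : set R) : 0 < r < 1 ->
  measurable_fun D (EFin \o (fun t => k *
    (c / normc (1 - peak_pole n * circle_pt r t)) `^ q)).
Proof.
move=> r01; apply: measurable_funS (@subsetT _ D) _ => //; apply/measurable_EFinP.
apply: measurable_funM; first exact: measurable_cst.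
apply: (@measurableT_comp _ _ _ _ _ _ (@powR R ^~ q)) => //.
apply: measurable_funM; first exact: measurable_cst.
apply: continuous_measurable_fun => t; apply: cvgV.
  rewrite gt_eqF// (lt_le_trans (peak_width_gt0 n))// normc_1B_peak_pole_ge//.
  exact: circle_pt_disc.
have h1 : holomorphic_on_disc (fun z : R[i] => 1 - peak_pole n * z).
  apply: (@holomorphicB _ (fun=> 1) (fun z => peak_pole n * z)).
    exact: holomorphic_cst.
  by apply: (@holomorphicZ _ id) => z _; exact: derivable_id.
exact: (continuous_normc_circle h1 r01).
Qed.

(** The q-th power is dominated by a series of nonnegative terms, integral and sum are exchanged,
    and the j-th integral is at most K e^{-j} with [K] independent of the radius. *)
Lemma hardy_sup_peak_sum_fin2 q : 2 <= q < s -> (hardy_sup (peak_sum s) q < +oo)%E.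
Proof.
move=> qs; have [K Kj] := peak_exponent qs.
have [q2 _] := andP qs; have q0 : 0 < q by apply: lt_le_trans q2.
have G0 := @geom_bound_gt0 R.
apply: (@le_lt_trans _ _ (geom_bound `^ q * (K * geom_bound))%:E); last exact: ltry.
apply: ge_ereal_sup => _ [r r01 <-]; rewrite /arc_integral.
pose x j t := peak_coef s j / normc (1 - peak_pole j * circle_pt r t).
pose T j t := expR (j%:R * q) * x j t `^ q.
have T0 j t : (0 <= (T j t)%:E)%E by rewrite lee_fin mulr_ge0 ?expR_ge0 ?powR_ge0.
have mT j (D : set R) : measurable_fun D (EFin \o T j) by exact: measurable_peak_term.
have intT j : (\int[lebesgue_measure]_(t in `[0%R, (2 * pi : R)%R]) (T j t)%:E <=
    (K * expR (- j%:R))%:E)%E.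
  pose k := expR (j%:R * q) * (peak_coef s j `^ q * (peak_width j)^-1 `^ (q - 2)).
  have k0 : 0 <= k by rewrite !mulr_ge0 ?expR_ge0 ?powR_ge0.
  have mN : measurable_fun `[0%R, (2 * pi : R)%R] (EFin \o (fun t =>
      (normc (1 - peak_pole j * circle_pt r t) ^+ 2)^-1)).
    have := @measurable_peak_term j r 2 1 1 `[0%R, (2 * pi : R)%R] r01.
    congr (measurable_fun _ _); apply/funext => t /=.
    by rewrite mul1r div1r powR_mulrn ?invr_ge0 ?normc_ge0// exprVn.
  apply: (@le_trans _ _ (\int[lebesgue_measure]_(t in `[0%R, (2 * pi : R)%R])
      (k%:E * ((normc (1 - peak_pole j * circle_pt r t) ^+ 2)^-1)%:E))%E).
    apply: ge0_le_integral => //.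
    - exact: mT.
    - exact: measurable_funeM.
    - move=> t _; rewrite -EFinM lee_fin /T /k -!mulrA ler_wpM2l ?expR_ge0// mulrA.
      apply: cauchy_term_powR => //; rewrite ?peak_coef_ge0 ?peak_width_gt0//.
      by rewrite normc_1B_peak_pole_ge//; exact: circle_pt_disc.
  rewrite ge0_integralZl//; last first.
    by move=> t _; rewrite lee_fin invr_ge0 sqr_ge0.
  apply: le_trans (lee_wpmul2l _ (integral_sqr_kernel j r01)) _; first by rewrite lee_fin.
  by rewrite -EFinM lee_fin; apply: le_trans (Kj j); rewrite /k !mulrA.
apply: (@le_trans _ _ (\int[lebesgue_measure]_(t in `[0%R, (2 * pi : R)%R])
    ((geom_bound `^ q)%R%:E * \sum_(j <oo) (T j t)%:E))%E).
  apply: ge0_le_integral => //.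
  - by move=> t _; rewrite lee_fin powR_ge0.
  - exact: (measurable_arc _ (holomorphic_peak_sum s2) r01).
  - apply: measurable_funeM; apply: ge0_emeasurable_sum => // j _; exact: mT.
  - move=> t _; apply: powR_le_nneseries => //; rewrite ?normc_ge0//.
    + by move=> j; rewrite divr_ge0 ?peak_coef_ge0 ?normc_ge0.
    + by move=> L; apply: normc_peak_sum_le; exact: circle_pt_disc.
rewrite ge0_integralZl//; last 3 first.
- by apply: ge0_emeasurable_sum => // j _; exact: mT.
- by move=> t _; apply: nneseries_ge0.
- by rewrite lee_fin powR_ge0.
rewrite integral_nneseries//; last by move=> j; exact: mT.
rewrite EFinM lee_wpmul2l ?lee_fin ?powR_ge0//.
apply: lime_le; first by apply: is_cvg_nneseries => n _ _; exact: integral_ge0.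
apply: nearW => n; apply: (@le_trans _ _ (\sum_(0 <= j < n) (K * expR (- j%:R))%:E)%E).
  by apply: lee_sum => j _.
rewrite sumEFin lee_fin big_mkord -mulr_sumr ler_wpM2l ?sum_expRN//.
(* The case j = 0 of the bound shows that [K] is nonnegative. *)
have := Kj 0%N; rewrite oppr0 expR0 mulr1; apply: le_trans.
by rewrite !mulr_ge0 ?expR_ge0 ?powR_ge0 ?pi_ge0// invr_ge0 ltW// peak_width_gt0.
Qed.

Lemma hardy_sup_peak_sum_fin q : 0 < q < s -> (hardy_sup (peak_sum s) q < +oo)%E.
Proof.
move=> /andP[q0 qs]; have hF := holomorphic_peak_sum s2.
have pi2 : 0 <= 2 * pi :> R by rewrite mulr_ge0// pi_ge0.
(* Exponents below 2 are raised to 2, which is still less than [s]. *)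
have qq : 0 <= q <= Num.max 2 q by rewrite ltW//= le_max lexx orbT.
apply: le_lt_trans (arc_sup_exponent hF qq pi2) _.
rewrite lte_add_pinfty ?ltry//; apply: hardy_sup_peak_sum_fin2.
by rewrite le_max lexx/= gt_max s2.
Qed.

End PeakSumHardy.

(** * Passage to arbitrary exponents and conclusion *)

Section Existence.
Context {R : realType}.

Lemma hardy_cap_infinite_arcs (p : R) : 0 < p ->
  exists v : hardy_cap p, forall a b, a < b -> arc_sup v p a b = +oo%E.
Proof.
(* [N] is chosen with N p > 2, as the peak series requires; the N-th power then satisfies |g|^q =
   |F|^{Nq} on the disc. *)
move=> p0; pose N := (Num.truncn (2 / p)).+1.
have s2 : 2 < N%:R * p by rewrite -ltr_pdivrMr// truncnS_gt.
have hF := holomorphic_peak_sum s2.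
pose g z : R[i] := if normc z < 1 then peak_sum (N%:R * p) z ^+ N else 0.
have gE z : unit_disc z -> g z = peak_sum (N%:R * p) z ^+ N.
  by move=> /unit_discE; rewrite /g => ->.
have gsup q a b : arc_sup g q a b = arc_sup (peak_sum (N%:R * p)) (N%:R * q) a b.
  congr ereal_sup; apply: eq_imagel => r r01; apply: eq_integral => t _.
  rewrite gE; last exact: circle_pt_disc.
  by rewrite normcX -powR_mulrn ?normc_ge0// -powRrM.
have gholo : holomorphic_on_disc g.
  apply: (@eq_on_disc_holomorphic _ (fun z => peak_sum (N%:R * p) z ^+ N)).
    by move=> z /gE.
  exact: holomorphicX.
have gout z : ~ unit_disc z -> g z = 0.
  by move=> zD; rewrite /g; case: ifPn => // /unit_discE.
have gfin q : 0 < q < p -> (hardy_sup g q < +oo)%E.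
  move=> /andP[q0 qp]; rewrite /hardy_sup gsup; apply: hardy_sup_peak_sum_fin => //.
  by rewrite mulr_gt0//= ltr_pM2l.
by exists (HardyCap gholo gout gfin) => a b ab; rewrite /= gsup arc_sup_peak_sum.
Qed.

End Existence.

Unset Implicit Arguments.
Set Strict Implicit.

Theorem theoremA (R : realType) (p : R) (hp : 0 < p) :
  (exists f : R[i] -> R[i], holomorphic_on_disc f /\ exceptional p f) /\
  Gdelta [set f : hardy_cap p | exceptional p f] /\
  dense [set f : hardy_cap p | exceptional p f].
Proof.
have [v voo] := hardy_cap_infinite_arcs hp.
split; last by split; [exact: Gdelta_exceptional|exact: dense_exceptional voo].
exists v; split; first by move=> z; exact: hardy_fun_holo.
apply/exceptional_capP => // x y /and3P[_ xy _].
by apply: voo; rewrite ltr_rat.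
Qed.
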